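(* Let $X$ be an affine normal complex variety. Then $\mathcal{K}^0(X(\mathbb{C})) = \mathcal{O}_X(X(\mathbb{C})) = \mathbb{C}[X]$.
   Context: An affine complex variety is $X=\operatorname{Spec}(\mathbb{C}[X])$ with $\mathbb{C}[X]$ a reduced finitely generated $\mathbb{C}$-algebra ($X$ need not be irreducible); it is normal if $\mathbb{C}[X]$ is integrally closed in its total ring of fractions. $X(\mathbb{C})$ is the set of closed points of $X$, identified with a Zariski closed subset of some $\mathbb{C}^n$; elements of $\mathbb{C}[X]$ are identified with polynomial functions on $X(\mathbb{C})$. $\mathcal{O}_X(X(\mathbb{C}))$ is the ring of regular functions on $X(\mathbb{C})$. A function $f:X(\mathbb{C})\to\mathbb{C}$ is rational if it is regular on some Zariski dense Zariski open subset of $X(\mathbb{C})$. $\mathcal{K}^0(X(\mathbb{C}))$ is the ring of functions $f:X(\mathbb{C})\to\mathbb{C}$ that are rational and continuous on all of $X(\mathbb{C})$ for the Euclidean topology. *)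

(* Defs.v *)
From HB Require Import structures.
From mathcomp Require Import all_boot all_order all_algebra ssrAC.
From mathcomp Require Import generic_quotient complex.
From mathcomp Require Import all_classical all_reals all_analysis.

Set Implicit Arguments.
Unset Strict Implicit.
Unset Printing Implicit Defensive.

Import Order.TTheory GRing.Theory Num.Theory numFieldNormedType.Exports.

Local Open Scope classical_set_scope.
Local Open Scope ring_scope.

(* mathcomp's [fraction] only covers integral domains, and [comNzRingType]
   excludes the zero ring, which is the coordinate ring of the empty variety;
   so fractions and integrality are developed here for [comPzRingType]. *)

Definition nonzerodivisor (A : comPzRingType) : pred A :=
  fun s => `[< forall t : A, s * t = 0 -> t = 0 >].

Section NonZeroDivisor.
Context (A : comPzRingType).

Lemma nonzerodivisorP (s : A) :
  reflect (forall t : A, s * t = 0 -> t = 0) (nonzerodivisor s).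
Proof. exact: asboolP. Qed.

Lemma nonzerodivisor1 : nonzerodivisor (1 : A).
Proof. by apply/nonzerodivisorP => t; rewrite mul1r. Qed.

Lemma nonzerodivisorM (s t : A) :
  nonzerodivisor s -> nonzerodivisor t -> nonzerodivisor (s * t).
Proof.
move=> /nonzerodivisorP hs /nonzerodivisorP ht; apply/nonzerodivisorP => u.
by rewrite -mulrA => /hs/ht.
Qed.

Lemma nonzerodivisorI (s : A) :
  nonzerodivisor s -> injective ( *%R s).
Proof.
move=> /nonzerodivisorP hs t u stu.
by apply/eqP; rewrite -subr_eq0; apply/eqP/hs; rewrite mulrBr stu subrr.
Qed.

End NonZeroDivisor.

Record nzd_ratio (A : comPzRingType) := MkNzdRatio {
  nzd_pair :> A * A;
  nzd_pairP : nonzerodivisor nzd_pair.2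
}.

HB.instance Definition _ (A : comPzRingType) :=
  [isSub for @nzd_pair A].
HB.instance Definition _ (A : comPzRingType) :=
  [Choice of nzd_ratio A by <:].

Module TotalFrac.
Section TotalFrac.
Context (A : comPzRingType).
Implicit Types x y z : nzd_ratio A.

Local Open Scope quotient_scope.

Definition equivf x y : bool := x.1 * y.2 == x.2 * y.1.

Lemma equivf_refl : reflexive equivf.
Proof. by move=> x; rewrite /equivf mulrC. Qed.

Lemma equivf_sym : symmetric equivf.
Proof.
by move=> x y; rewrite /equivf eq_sym; congr (_ == _); rewrite mulrC.
Qed.

Lemma equivf_trans : transitive equivf.
Proof.
move=> y x z /eqP xy /eqP yz; apply/eqP; apply: (nonzerodivisorI (nzd_pairP y)).
by rewrite mulrA [y.2 * _]mulrC xy -mulrA yz mulrCA.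
Qed.

Canonical equivf_equiv := EquivRel equivf equivf_refl equivf_sym equivf_trans.

Definition type := {eq_quot equivf}.

HB.instance Definition _ : EqQuotient _ equivf type := EqQuotient.on type.
HB.instance Definition _ := Choice.on type.

Lemma eq_piP x y :
  reflect (x.1 * y.2 = x.2 * y.1) (\pi_type x == \pi_type y).
Proof. by rewrite eqmodE; exact: eqP. Qed.

Lemma equivf_r x :
  x.1 * (repr (\pi_type x)).2 = x.2 * (repr (\pi_type x)).1.
Proof. by apply/eq_piP; rewrite reprK. Qed.

Definition mk (a s : A) (hs : nonzerodivisor s) : nzd_ratio A :=
  @MkNzdRatio A (a, s) hs.

Definition inj (a : A) : nzd_ratio A := mk a (nonzerodivisor1 A).

Definition tofrac := lift_embed type inj.
Canonical tofrac_pi_morph := PiEmbed tofrac.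

Definition addf x y : nzd_ratio A :=
  mk (x.1 * y.2 + y.1 * x.2) (nonzerodivisorM (nzd_pairP x) (nzd_pairP y)).
Definition add := lift_op2 type addf.

Lemma pi_add : {morph \pi : x y / addf x y >-> add x y}.
Proof.
move=> x y; unlock add; apply/eqP/eq_piP => /=.
have := equivf_r x; have := equivf_r y.
move: (repr (\pi_type x)) (repr (\pi_type y)) => x' y' ey ex.
rewrite mulrDl mulrDr; congr (_ + _).
  by rewrite mulrACA ex mulrACA.
by rewrite (AC (2*2) ((1*4)*(2*3)))/= ey (AC (2*2) ((3*1)*(2*4))).
Qed.
Canonical pi_add_morph := PiMorph2 pi_add.

Definition oppf x : nzd_ratio A := mk (- x.1) (nzd_pairP x).
Definition opp := lift_op1 type oppf.

Lemma pi_opp : {morph \pi : x / oppf x >-> opp x}.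
Proof.
move=> x; unlock opp; apply/eqP/eq_piP => /=.
by rewrite mulNr mulrN -equivf_r.
Qed.
Canonical pi_opp_morph := PiMorph1 pi_opp.

Definition mulf x y : nzd_ratio A :=
  mk (x.1 * y.1) (nonzerodivisorM (nzd_pairP x) (nzd_pairP y)).
Definition mul := lift_op2 type mulf.

Lemma pi_mul : {morph \pi : x y / mulf x y >-> mul x y}.
Proof.
move=> x y; unlock mul; apply/eqP/eq_piP => /=.
by rewrite mulrACA !equivf_r mulrACA.
Qed.
Canonical pi_mul_morph := PiMorph2 pi_mul.

Lemma ratio_eq x y : x.1 = y.1 -> x.2 = y.2 -> x = y.
Proof.
by case: x => -[a s] ?; case: y => -[b t] ? /= e1 e2; apply/val_inj;
  rewrite /= e1 e2.
Qed.

Lemma addA : associative add.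
Proof.
elim/quotW=> x; elim/quotW=> y; elim/quotW=> z; rewrite !piE.
congr (\pi _); apply: ratio_eq => /=; last by rewrite mulrA.
by rewrite !mulrDl !mulrA !addrA ![_ * _ * x.2]mulrAC.
Qed.

Lemma addC : commutative add.
Proof.
elim/quotW=> x; elim/quotW=> y; rewrite !piE.
by congr (\pi _); apply: ratio_eq => /=; [rewrite addrC | rewrite mulrC].
Qed.

Lemma add0 : left_id (tofrac 0) add.
Proof.
elim/quotW=> x; rewrite !piE.
by congr (\pi _); apply: ratio_eq => /=; rewrite ?mul0r ?mul1r ?mulr1 ?add0r.
Qed.

Lemma addN : left_inverse (tofrac 0) opp add.
Proof.
elim/quotW=> x; rewrite !piE; apply/eqP/eq_piP => /=.
by rewrite mulr1 mulr0 mulNr addNr.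
Qed.

HB.instance Definition _ := GRing.isZmodule.Build type addA addC add0 addN.

Lemma mulA : associative mul.
Proof.
elim/quotW=> x; elim/quotW=> y; elim/quotW=> z; rewrite !piE.
by congr (\pi _); apply: ratio_eq => /=; rewrite mulrA.
Qed.

Lemma mulC : commutative mul.
Proof.
elim/quotW=> x; elim/quotW=> y; rewrite !piE.
by congr (\pi _); apply: ratio_eq => /=; rewrite mulrC.
Qed.

Lemma mul1 : left_id (tofrac 1) mul.
Proof.
elim/quotW=> x; rewrite !piE.
by congr (\pi _); apply: ratio_eq => /=; rewrite mul1r.
Qed.

Lemma mulDl : left_distributive mul add.
Proof.
elim/quotW=> x; elim/quotW=> y; elim/quotW=> z.
rewrite !piE; apply/eqP/eq_piP => /=.
have -> : x.1 * z.1 * (y.2 * z.2) + y.1 * z.1 * (x.2 * z.2)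
          = (x.1 * y.2 + y.1 * x.2) * (z.1 * z.2).
  by rewrite mulrDl !(mulrACA _ z.1).
by rewrite (AC (2*(2*2)) (((3*5)*4)*(1*(2*6)))).
Qed.

HB.instance Definition _ :=
  GRing.Zmodule_isComPzRing.Build type mulA mulC mul1 mulDl.

Lemma tofrac_is_zmod_morphism : zmod_morphism tofrac.
Proof.
move=> a b; unlock tofrac.
rewrite -[X in _ = _ + X]pi_opp -[RHS]pi_add.
by congr (\pi _); apply: ratio_eq => /=; rewrite ?mulr1.
Qed.

Lemma tofrac_is_monoid_morphism : monoid_morphism tofrac.
Proof.
split=> [//|a b]; unlock tofrac; rewrite -[RHS]pi_mul.
by congr (\pi _); apply: ratio_eq => /=; rewrite ?mulr1.
Qed.

HB.instance Definition _ :=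
  GRing.isZmodMorphism.Build A type tofrac tofrac_is_zmod_morphism.
HB.instance Definition _ :=
  GRing.isMonoidMorphism.Build A type tofrac tofrac_is_monoid_morphism.

Lemma tofrac_inj : injective tofrac.
Proof.
move=> a b; unlock tofrac => /eqP/eq_piP /=.
by rewrite mulr1 mul1r.
Qed.

(* Every element of the total ring of fractions is a/s, with s becoming
   invertible. *)
Lemma tofrac_surj (u : type) :
  exists a s, nonzerodivisor s /\ u * tofrac s = tofrac a.
Proof.
elim/quotW: u => x; exists x.1, x.2; split; first exact: nzd_pairP.
unlock tofrac; rewrite -[LHS]pi_mul; apply/eqP/eq_piP => /=.
by rewrite !mulr1 mulrC.
Qed.

Lemma tofrac_unit (s : A) :
  nonzerodivisor s -> exists u : type, tofrac s * u = 1.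
Proof.
move=> hs; exists (\pi_type (mk 1 hs)).
unlock tofrac; rewrite -[LHS]pi_mul -[RHS]/(tofrac 1).
unlock tofrac; apply/eqP/eq_piP => /=.
by rewrite !mulr1 !mul1r.
Qed.

End TotalFrac.
End TotalFrac.
HB.export TotalFrac.

Definition total_fraction (A : comPzRingType) : comPzRingType :=
  TotalFrac.type A.

Definition to_total_fraction (A : comPzRingType) :
    {rmorphism A -> total_fraction A} :=
  @TotalFrac.tofrac A.

Definition integral_over (A B : comPzRingType) (f : {rmorphism A -> B})
    (u : B) : Prop :=
  exists (m : nat) (c : 'I_m -> A), u ^+ m + \sum_(i < m) f (c i) * u ^+ i = 0.

Definition normal_ring (A : comPzRingType) : Prop :=
  forall u : total_fraction A, integral_over (to_total_fraction A) u ->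
    exists a : A, u = to_total_fraction A a.

Definition reduced_ring (A : comPzRingType) : Prop :=
  forall (a : A) (k : nat), a ^+ k = 0 -> a = 0.

(* The notations of mpoly clash with those of mathcomp-analysis; hence
   [mpoly n C] for polynomials in n variables and [meval v P] for P(v). *)
From mathcomp Require Import -(notations) mpoly.

(* The complex numbers, typed as a [numClosedFieldType] so that the Euclidean
   topology that mathcomp-analysis puts on number fields, and on row vectors
   over them, is found. *)
Definition Cx (R : realType) : numClosedFieldType := R[i].

Section ZariskiTopology.
Context (R : realType) (n : nat) (X : set 'rV[Cx R]_n).
Implicit Types (Z U : set X) (f : X -> Cx R) (p : X).

Definition peval (P : mpoly n (Cx R)) p : Cx R := meval (set_val p ord0) P.

Definition zariski_closed Z : Prop :=
  exists S : set (mpoly n (Cx R)), Z = [set p | forall P, S P -> peval P p = 0].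

Definition zariski_open U : Prop := zariski_closed (~` U).

Definition zariski_dense U : Prop :=
  forall Z, zariski_closed Z -> U `<=` Z -> Z = setT.

Definition regular_on U f : Prop :=
  forall p, U p -> exists (V : set X) (P Q : mpoly n (Cx R)),
    [/\ zariski_open V, V p, V `<=` U &
        forall q, V q -> peval Q q != 0 /\ f q = peval P q / peval Q q].

Definition rational_fun f : Prop :=
  exists U, [/\ zariski_open U, zariski_dense U & regular_on U f].

Definition regular_functions : set (X -> Cx R) := [set f | regular_on setT f].

(* [X] carries the topology induced by the Euclidean topology of C^n. *)
Definition continuous_rational_functions : set (X -> Cx R) :=
  [set f | rational_fun f /\ continuous f].

End ZariskiTopology.

Arguments regular_functions {R n} X.
Arguments continuous_rational_functions {R n} X.

(* A finitely generated C-algebra [A], with a choice of n generators, is given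
   as a quotient phi : C[x_1, ..., x_n] -> A (phi surjective); the C-algebra
   structure of [A] is the restriction of phi to constants. This choice embeds
   the closed points of Spec A in C^n, as the zero set of the kernel of phi. *)
Section AffineVariety.
Context (R : realType) (n : nat) (A : comPzRingType).
Context (phi : {rmorphism mpoly n (Cx R) -> A}).

Definition closed_points : set 'rV[Cx R]_n :=
  [set v | forall P, phi P = 0 -> meval (v ord0) P = 0].

(* The function on the closed points defined by an element of [A]: evaluate
   any polynomial that represents it, see [coord_funE]. *)
Definition coord_fun (a : A) : closed_points -> Cx R :=
  peval (xget 0 [set P | phi P = a]).

Lemma coord_funE (P : mpoly n (Cx R)) : coord_fun (phi P) = peval P.
Proof.
rewrite /coord_fun; set S := [set Q | phi Q = phi P].
have : S (xget 0 S) by exact: (xgetPex 0 (ex_intro S P erefl)).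
move: (xget 0 S) => Q QP; apply/funext => p.
apply/eqP; rewrite -subr_eq0 /peval -mevalB; apply/eqP.
by apply: (set_valP p); rewrite rmorphB QP subrr.
Qed.

End AffineVariety.

Arguments closed_points {R n A} phi.
Arguments coord_fun {R n A} phi a.

(* Main.v *)
(* Let f be a continuous rational function on X. As A is reduced and noetherian,
   f has a denominator s that is a nonzerodivisor of A, so f = a / s.

   If f is integral over A, then it belongs to A by normality, so that f coincides
   with a polynomial function on D(s), hence on X: D(s) is dense in X for the
   Euclidean topology.

   If f is not integral over A, the leading coefficients of the polynomials over A
   that vanish at f form a proper ideal, hence have a common zero x0 in X. Then
   (x0, 0) lies on the Zariski closure of the graph of 1 / f, and Euclidean density
   again provides points of X near x0 where 1 / f is arbitrarily small but nonzero,
   which contradicts the continuity of f at x0.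

   Euclidean density is proved for the specializations, in the sense of Weil, of a
   tuple x of elements of a field extension K of C, i.e. the tuples of complex
   numbers satisfying all the polynomial relations between the coordinates of x. *)
Require Import Defs.
From HB Require Import structures.
From mathcomp Require Import all_boot all_order all_algebra.
From mathcomp Require Import complex.
From mathcomp Require Import all_classical all_reals all_analysis.
From mathcomp Require Import -(notations) mpoly.
From mathcomp Require Import all_field zify ring generic_quotient.

Set Implicit Arguments.
Unset Strict Implicit.
Unset Printing Implicit Defensive.

Import Order.TTheory GRing.Theory Num.Theory numFieldNormedType.Exports.

Local Open Scope classical_set_scope.
Local Open Scope ring_scope.

(** * Noetherian rings and multivariate polynomials *)

(** [X] may be reducible, so the generic tuple has to be constructed: it comes from an ideal maximal
    among those that contain the equations and avoid a multiplicative set adapted to the given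
    point. This selects an irreducible closed subset through the point on which the required
    functions are not identically zero. The obstacle is Euclidean density. Noether normalization
    presents the specializations as a finite cover of an affine space, where a nonzero polynomial
    has nonzero values arbitrarily close to any point; but a lift of a nearby base point may land
    near another point of the fibre. A linear form that separates the fibre tells its points apart.
    As polynomial rings are integrally closed, the minimal polynomial of this form over the base is
    monic with polynomial coefficients and divides all relations of the form, so that its small
    roots over a generic base point do come from specializations. *)

Definition in_span (R : comNzRingType) (c : nat -> R) (k : nat) (p : R) : Prop :=
  exists r : nat -> R, p = \sum_(i < k) r i * c i.

(** The ascending chain condition for the ideals generated by the initial segments of a sequence,
    the form in which [exists_nonzerodivisor] uses it. *)
Definition noetherian (R : comNzRingType) : Prop :=
  forall c : nat -> R, exists k, in_span c k (c k).

Section Span.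
Context (R : comNzRingType) (c : nat -> R).

Lemma in_spanD k p q : in_span c k p -> in_span c k q -> in_span c k (p + q).
Proof.
move=> [r ->] [s ->]; exists (fun i => r i + s i).
by rewrite -big_split; apply: eq_bigr => i _; rewrite mulrDl.
Qed.

Lemma in_spanM k a p : in_span c k p -> in_span c k (a * p).
Proof.
move=> [r ->]; exists (fun i => a * r i).
by rewrite mulr_sumr; apply: eq_bigr => i _; rewrite mulrA.
Qed.

Lemma in_span0 k : in_span c k 0.
Proof. by exists (fun=> 0); rewrite big1 // => i _; rewrite mul0r. Qed.

Lemma in_span_sum (I : Type) (s : seq I) (P : pred I) (F : I -> R) k :
  (forall i, P i -> in_span c k (F i)) -> in_span c k (\sum_(i <- s | P i) F i).
Proof.
by move=> hF; elim/big_ind: _ => //; [exact: in_span0 | exact: in_spanD].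
Qed.

Lemma in_span_gen k i : (i < k)%N -> in_span c k (c i).
Proof.
move=> ik; exists (fun j => (j == i)%:R).
rewrite (bigD1 (Ordinal ik)) //= eqxx mul1r big1 ?addr0 // => j.
by rewrite -val_eqE /= => /negbTE ->; rewrite mul0r.
Qed.

Lemma in_span_le k m p : (k <= m)%N -> in_span c k p -> in_span c m p.
Proof.
move=> km [r ->]; apply: in_span_sum => i _.
by apply/in_spanM/in_span_gen/(leq_trans _ km).
Qed.

End Span.

Lemma noetherian_surj (R S : comNzRingType) (f : {rmorphism R -> S}) :
  (forall y, exists x, f x = y) -> noetherian R -> noetherian S.
Proof.
move=> /choice[g gK] noR c; have [k [r e]] := noR (g \o c).
exists k, (f \o r); rewrite -[c k]gK [g (c k)]e rmorph_sum.
by apply: eq_bigr => i _; rewrite /= rmorphM gK.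
Qed.

Lemma noetherian_field (F : fieldType) : noetherian F.
Proof.
move=> c; have [c0|c0] := eqVneq (c 0%N) 0.
  by exists 0%N; rewrite c0; apply: in_span0.
by exists 1%N, (fun=> c 1%N / c 0%N); rewrite big_ord1 divfK.
Qed.

(** Hilbert's basis theorem: a relation between the leading coefficients of the sequence [f] yields
    an element of [I] outside the span of the earlier terms but of smaller size than [f k]. *)
Lemma noetherian_poly (R : comNzRingType) :
  noetherian R -> noetherian {poly R}.
Proof.
move=> noR c; apply: contrapT => /forallNP noc.
pose I p := exists m, in_span c m p.
have Iin m p : in_span c m p -> I p by exists m.
have Iadd p q : I p -> I q -> I (p + q).
  move=> [m hm] [l hl]; exists (maxn m l).
  by apply: in_spanD; [apply: in_span_le hm; rewrite leq_maxl
    | apply: in_span_le hl; rewrite leq_maxr].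
have Imul a p : I p -> I (a * p) by move=> [m hm]; exists m; apply: in_spanM.
(* [step s] picks an element of least size of the ideal [I] outside the span
   of [s]; iterating it gives the sequence [f] of Hilbert's argument. *)
have step (s : seq {poly R}) : exists p, (forall q, q \in s -> I q) ->
    [/\ I p, ~ in_span (nth 0 s) (size s) p &
      forall q, I q -> ~ in_span (nth 0 s) (size s) q -> (size p <= size q)%N].
  have [Is|] := pselect (forall q, q \in s -> I q); last by exists 0.
  suff [p [Ip np]] : exists p, I p /\ ~ in_span (nth 0 s) (size s) p.
    pose Q k := `[< exists p, [/\ I p, ~ in_span (nth 0 s) (size s) p
                   & size p = k] >].
    have exQ : exists k, Q k by exists (size p); apply/asboolP; exists p.
    have [k /asboolP[q [Iq nq sq]] kmin] := ex_minnP exQ.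
    exists q => _; split=> // q' Iq' nq'; rewrite sq; apply: kmin.
    by apply/asboolP; exists q'.
  have [m hm] : exists m, forall q, q \in s -> in_span c m q.
    elim: s Is => [|q s IHs] Is; first by exists 0%N.
    have [|m hm] := IHs; first by move=> q' q's; apply: Is; rewrite inE q's orbT.
    have [l hl] := Is q (mem_head _ _).
    exists (maxn m l) => q'; rewrite inE => /predU1P[->|/hm].
      by apply: in_span_le hl; rewrite leq_maxr.
    by apply: in_span_le; rewrite leq_maxl.
  exists (c m); split; first by exists m.+1; apply: in_span_gen.
  move=> [r e]; apply: (noc m); rewrite e; apply: in_span_sum => i _.
  by apply/in_spanM/hm/mem_nth.
have {step}[next nextP] := choice step.
pose S := fix S k := if k is k'.+1 then rcons (S k') (next (S k')) else [::].
pose f k := next (S k).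
have SE k : S k = mkseq f k.
  by elim: k => [|k IHk] //; rewrite mkseqS -IHk.
have spanE k p : in_span (nth 0 (S k)) (size (S k)) p <-> in_span f k p.
  rewrite SE size_mkseq; split=> -[r ->]; exists r; apply: eq_bigr => i _;
    by rewrite nth_mkseq.
have SI k : (forall i, (i < k)%N -> I (f i)) -> forall q, q \in S k -> I q.
  move=> fI q; rewrite SE => /mapP[j].
  by rewrite mem_iota => /= /fI fiI ->.
have fI k : I (f k).
  have [n] := ubnP k; elim: n k => // n IHn k; rewrite ltnS => kn.
  have [|//] := nextP (S k); apply: SI => i ik.
  by apply: IHn; apply: leq_trans ik kn.
have fP k : ~ in_span f k (f k) /\
    forall q, I q -> ~ in_span f k q -> (size (f k) <= size q)%N.
  have [|_ n1 n2] := nextP (S k); first by apply: SI => i _.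
  by split=> [/spanE//|q Iq nq]; apply: n2 => // /spanE.
have f_neq0 k : f k != 0.
  by apply/eqP => fk0; have [] := fP k; rewrite fk0; case; exact: in_span0.
have fle i k : (i <= k)%N -> (size (f i) <= size (f k))%N.
  move=> ik; apply: (fP i).2 => // h; apply: (fP k).1.
  exact: in_span_le h.
have [k [r e]] := noR (fun k => lead_coef (f k)).
(* The powers of ['X] bring all terms to the size of [f k], which is possible because the sizes of
   [f] do not decrease ([fle]). *)
pose g := f k - \sum_(i < k) (r i)%:P * 'X^(size (f k) - size (f i)) * f i.
have hsum : in_span f k
    (\sum_(i < k) (r i)%:P * 'X^(size (f k) - size (f i)) * f i).
  by apply: in_span_sum => i _; apply/in_spanM/in_span_gen.
have gI : I g.
  apply: (Iadd) => //; rewrite -mulN1r; apply: (Imul).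
  have h (s : seq 'I_k) (F : 'I_k -> {poly R}) :
    (forall i, I (F i)) -> I (\sum_(i <- s) F i).
    move=> hF; apply: (big_ind I) => [|p q|i _]; [|exact: Iadd|exact: hF].
    by exists 0%N; exact: in_span0.
  by apply: h => i; apply: Imul.
have gn : ~ in_span f k g.
  move=> gs; apply: (fP k).1.
  rewrite -[f k](subrK (\sum_(i < k) (r i)%:P * 'X^(size (f k) - size (f i)) * f i)).
  exact: in_spanD.
have := (fP k).2 _ gI gn; apply/negP; rewrite -ltnNge.
rewrite -(prednK (_ : 0 < size (f k))%N) ?size_poly_gt0 // ltnS.
apply/leq_sizeP => j; rewrite leq_eqVlt => /predU1P[<-|jk].
  rewrite coefB -[(f k)`_ _]/(lead_coef (f k)) e coef_sum.
  apply/eqP; rewrite subr_eq0; apply/eqP/eq_bigr => i _.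
  rewrite -mulrA coefCM coefXnM.
  have fi0 : (0 < size (f i))%N by rewrite size_poly_gt0.
  have fik : (size (f i) <= size (f k))%N by apply: fle; rewrite ltnW.
  rewrite ifF; last by lia.
  by congr (_ * (f i)`_ _); lia.
have kj : (size (f k) <= j)%N by lia.
rewrite coefB (leq_sizeP _ _ (leqnn _)) // sub0r coef_sum big1 ?oppr0 // => i _.
rewrite -mulrA coefCM coefXnM; case: ltnP => _; first by rewrite mulr0.
have fik : (size (f i) <= size (f k))%N by apply: fle; rewrite ltnW.
rewrite (leq_sizeP _ _ (leqnn _)) ?mulr0 //.
have le_sub (a b m : nat) : (a <= b -> b <= m -> a <= m - (b - a))%N by lia.
exact: le_sub fik kj.
Qed.

Lemma mpoly0E (R : comNzRingType) (p : mpoly 0 R) :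
  p = mpolyC 0 (mcoeff mnm0 p).
Proof.
apply/mpolyP => m; rewrite mcoeffC (_ : m = mnm0) ?eqxx ?mulr1 //.
by apply/mnmP => -[].
Qed.

Lemma mpoly_rmorph_eq (n : nat) (R S : comNzRingType)
    (f g : {rmorphism mpoly n R -> S}) :
  (forall c, f (mpolyC n c) = g (mpolyC n c)) ->
  (forall i, f (mpolyX R (mnm1 i)) = g (mpolyX R (mnm1 i))) -> f =1 g.
Proof.
move=> fgC fgX; elim/mpolyind => [|c m p _ _ IHp]; first by rewrite !rmorph0.
rewrite -mul_mpolyC !rmorphD !rmorphM IHp fgC mpolyXE_id !rmorph_prod.
by congr (_ * _ + _); apply: eq_bigr => i _; rewrite !rmorphXn fgX.
Qed.


(** * Splitting off the last variable of a polynomial *)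

Section Muni.
Context (n : nat) (R : comNzRingType).
Local Notation widen := (widen_ord (leqnSn n)).

Lemma muniX_widen (i : 'I_n) :
  muni (mpolyX R (mnm1 (widen i))) = (mpolyX R (mnm1 i))%:P.
Proof.
rewrite /muni mmapX mmap1U; case: splitP => [j eq|j].
  by congr ((mpolyX R (mnm1 _))%:P); apply/val_inj; rewrite /= -eq.
by rewrite ord1 /= addn0 => /eqP /=; rewrite ltn_eqF.
Qed.

Lemma muniX_max : muni (mpolyX R (mnm1 ord_max)) = 'X :> {poly mpoly n R}.
Proof.
rewrite /muni mmapX mmap1U; case: splitP => //.
case=> j lt_jn /eqP /=.
by have := lt_jn; rewrite ltn_neqAle eq_sym=> /andP[/negbTE->].
Qed.

Lemma ord_max_widenP (P : 'I_n.+1 -> Prop) :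
  (forall i, P (widen i)) -> P ord_max -> forall i, P i.
Proof.
move=> Pw Pm i; have [ltin|] := ltnP i n.
  by have := Pw (Ordinal ltin); congr P; exact: val_inj.
by move=> lein; rewrite (_ : i = ord_max) //; apply/val_inj/eqP;
  rewrite eqn_leq leq_ord.
Qed.

Lemma mwidenXU (i : 'I_n) :
  mwiden (mpolyX R (mnm1 i)) = mpolyX R (mnm1 (widen i)).
Proof. by rewrite mwidenX mnmwiden1. Qed.

Lemma mmap_muni (S : comNzRingType) (f : {rmorphism R -> S})
    (x : 'I_n.+1 -> S) (p : mpoly n.+1 R) :
  mmap f x p = (map_poly (mmap f (x \o widen)) (muni p)).[x ord_max].
Proof.
pose g : {rmorphism mpoly n.+1 R -> S} :=
  horner_eval (x ord_max) \o map_poly (mmap f (x \o widen)) \o (@muni n R).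
rewrite -[RHS]/(g p); move: p; apply: mpoly_rmorph_eq => [c|].
  by rewrite /g /= mmapC muniC map_polyC /= mmapC /horner_eval hornerC.
apply: ord_max_widenP => [i|]; rewrite /g /= mmapX mmap1U /horner_eval.
  by rewrite muniX_widen map_polyC /= mmapX mmap1U hornerC.
by rewrite muniX_max map_polyX hornerX.
Qed.

Definition mfold : {rmorphism {poly mpoly n R} -> mpoly n.+1 R} :=
  horner_eval (mpolyX R (mnm1 ord_max)) \o map_poly (@mwiden n R).

Lemma muniK p : mfold (muni p) = p.
Proof.
pose g : {rmorphism mpoly n.+1 R -> mpoly n.+1 R} := mfold \o (@muni n R).
rewrite -[LHS]/(g p) -[RHS]/(idfun p); move: p; apply: mpoly_rmorph_eq => [c|].
  by rewrite /g /= muniC map_polyC /horner_eval hornerC /= mwidenC.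
apply: ord_max_widenP => [i|]; rewrite /g /= /horner_eval.
  by rewrite muniX_widen map_polyC hornerC /= mwidenXU.
by rewrite muniX_max map_polyX hornerX.
Qed.

Lemma muni_mwiden (p : mpoly n R) : muni (mwiden p) = p%:P.
Proof.
pose g : {rmorphism mpoly n R -> {poly mpoly n R}} := (@muni n R) \o (@mwiden n R).
rewrite -[LHS]/(g p) -[RHS]/(polyC p); move: p; apply: mpoly_rmorph_eq => [c|i].
  by rewrite /g /= mwidenC muniC.
by rewrite /g /= mwidenXU muniX_widen.
Qed.

End Muni.

Lemma noetherian_mpoly (F : fieldType) n : noetherian (mpoly n F).
Proof.
elim: n => [|n IHn].
  apply: (noetherian_surj (f := @mpolyC 0 F) _ (@noetherian_field F)) => p.
  by exists (mcoeff mnm0 p); rewrite [RHS]mpoly0E.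
apply: (noetherian_surj (f := mfold n F)); last exact: noetherian_poly.
by move=> p; exists (muni p); rewrite muniK.
Qed.

(** [insub] fails only at [ord_max], which thus receives the default value [c]. *)
Definition ord_rcons (S : Type) n (x : 'I_n -> S) (c : S) (i : 'I_n.+1) : S :=
  oapp x c (insub (val i)).

Lemma ord_rcons_widen (S : Type) n (x : 'I_n -> S) c :
  ord_rcons x c \o widen_ord (leqnSn n) = x.
Proof.
apply/funext => i; rewrite /ord_rcons /= insubT ?ltn_ord // => lt.
by congr x; apply/val_inj.
Qed.

Lemma ord_rcons_max (S : Type) n (x : 'I_n -> S) c : ord_rcons x c ord_max = c.
Proof. by rewrite /ord_rcons insubF //= ltnn. Qed.

(** * Prime ideals and residue fields *)

Definition is_ideal (R : comNzRingType) (I : set R) : Prop :=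
  [/\ I 0, forall a b, I a -> I b -> I (a + b) & forall r a, I a -> I (r * a)].

Definition is_multiplicative (R : comNzRingType) (M : set R) : Prop :=
  M 1 /\ forall a b, M a -> M b -> M (a * b).

(** By Zorn's lemma some ideal is maximal among those that contain [J] and avoid [M]. If it
    contained [u v] but neither factor, adjoining [u] or [v] would meet [M], and the product of the
    two elements met would lie in the ideal and in [M]. *)
Lemma exists_prime (R : comNzRingType) (J M : set R) :
  is_ideal J -> is_multiplicative M -> J `&` M = set0 ->
  exists p : set R, [/\ is_ideal p, J `<=` p, p `&` M = set0 &
    forall u v, p (u * v) -> p u \/ p v].
Proof.
move=> [J0 JD JM] [M1 MM] JM0.
(* [I `|` J] rather than [I] so that the union of an empty chain qualifies. *)
pose P (I : set R) := is_ideal (I `|` J) /\ (I `|` J) `&` M = set0.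
have [F FP Ftot|A [[Aid AM] Amax]] := @Zorn_bigcup _ P.
  have dir a b : (\bigcup_(X in F) X `|` J) a -> (\bigcup_(X in F) X `|` J) b ->
      (J a /\ J b) \/ exists2 Z, F Z & (Z `|` J) a /\ (Z `|` J) b.
    move=> [[X FX Xa]|Ja] [[Y FY Yb]|Jb].
    - have [XY|YX] := Ftot _ _ FX FY; right.
        by exists Y => //; split; left=> //; apply: XY.
      by exists X => //; split; left=> //; apply: YX.
    - by right; exists X => //; split; [left|right].
    - by right; exists Y => //; split; [right|left].
    - by left.
  have sub Z : F Z -> Z `|` J `<=` \bigcup_(X in F) X `|` J.
    by move=> FZ x [Zx|Jx]; [left; exists Z|right].
  split; first split; first by right.
  - move=> a b ha hb; have [[Ja Jb]|[Z FZ [Za Zb]]] := dir _ _ ha hb.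
      by right; apply: JD.
    by apply: (sub _ FZ); have [[_ ZD _] _] := FP _ FZ; apply: ZD.
  - move=> r a ha; have [[Ja _]|[Z FZ [Za _]]] := dir _ _ ha ha.
      by right; apply: JM.
    by apply: (sub _ FZ); have [[_ _ ZM] _] := FP _ FZ; apply: ZM.
  rewrite -subset0 => x [hx Mx].
  have [[Jx _]|[Z FZ [Zx _]]] := dir _ _ hx hx.
    by move: (conj Jx Mx : (J `&` M) x); rewrite JM0.
  have [_ ZM0] := FP _ FZ.
  by move: (conj Zx Mx : ((Z `|` J) `&` M) x); rewrite ZM0.
have [A0 AD AMul] := Aid.
exists (A `|` J); split; [exact: Aid | by move=> x; right | exact: AM |].
have big u : ~ (A `|` J) u -> exists a r, (A `|` J) a /\ M (a + r * u).
  move=> Au; apply: contrapT => /forallNP nM.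
  pose B : set R := fun x => exists a r, (A `|` J) a /\ x = a + r * u.
  have AB : A `|` J `<=` B by move=> a Aa; exists a, 0; rewrite mul0r addr0.
  have Bid : is_ideal B; first split.
  - exact: AB.
  - move=> _ _ [a [r [Aa ->]]] [b [s [Ab ->]]]; exists (a + b), (r + s).
    by split; [apply: AD|rewrite mulrDl addrACA].
  - move=> s _ [a [r [Aa ->]]]; exists (s * a), (s * r).
    by split; [apply: AMul|rewrite mulrDr mulrA].
  have BJ : B `|` J = B.
    by apply/seteqP; split=> x; [case=> // Jx; apply: AB; right|left].
  apply: (Amax B).
    split; first by move=> x Ax; apply: AB; left.
    by move=> BA; apply: Au; left; apply: BA; exists 0, 1; rewrite mul1r add0r.
  rewrite /P BJ; split=> //; rewrite -subset0 => x [[a [r [Aa ->]]] Mx].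
  by apply: (nM a); exists r.
move=> u v puv; apply: contrapT => /not_orP[/big[a [r [Aa Ma]]] /big[b [s [Ab Mb]]]].
suff : (set0 : set R) ((a + r * u) * (b + s * v)) by [].
rewrite -AM; split; last exact: MM.
rewrite mulrDl; apply: (AD); first by rewrite mulrC; apply: (AMul).
rewrite mulrDr; apply: (AD); first exact: AMul.
by rewrite mulrACA; apply: AMul.
Qed.

Section PrimeQuotient.
Context (R : comNzRingType) (p : set R).
Hypotheses (p_ideal : is_ideal p) (p1 : ~ p 1).
Hypothesis p_prime : forall u v, p (u * v) -> p u \/ p v.

Let I : pred R := fun x => `[< p x >].

Fact I_idealr_closed : idealr_closed I.
Proof.
have [i0 iD iM] := p_ideal; split.
- exact/asboolP.
- exact/asboolP.
- by move=> a x y /asboolP px /asboolP py; apply/asboolP/iD => //; apply: iM.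
Qed.

Fact I_prime_closed : prime_idealr_closed I.
Proof.
move=> u v /asboolP/p_prime[pu|pv]; apply/orP; [left|right]; exact/asboolP.
Qed.
Let primeI : prime_idealr R := HB.pack I
  (isIdealr.Build R I I_idealr_closed)
  (isPrimeIdealrClosed.Build R I I_prime_closed).

Let Q : Type := {ideal_quot primeI}.
HB.instance Definition _ := GRing.ComNzRing.on Q.

(** The structure of integral domain includes a unit test and an inverse; classical choice supplies
    both, so that the fraction field of the quotient can be formed. *)
Let Qunit : pred Q := fun x => `[< exists y, y * x = 1 >].
Let Qinv (x : Q) : Q := if pselect (exists y, y * x = 1) is left h
  then projT1 (cid h) else x.

Fact QmulVx : {in Qunit, left_inverse 1 Qinv *%R}.
Proof.
move=> x /asboolP hx; rewrite /Qinv; case: pselect => // h.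
by case: (cid h).
Qed.

Fact Qunit_out : {in [predC Qunit], Qinv =1 id}.
Proof.
move=> x /negP hx; rewrite /Qinv; case: pselect => // h.
by case: hx; apply/asboolP.
Qed.

Fact QunitPl (x y : Q) : y * x = 1 -> Qunit x.
Proof. by move=> yx; apply/asboolP; exists y. Qed.

HB.instance Definition _ :=
  GRing.ComNzRing_hasMulInverse.Build Q QmulVx QunitPl Qunit_out.

Fact Qintegral : GRing.integral_domain_axiom Q.
Proof. exact: Quotient.rquot_IdomainAxiom. Qed.

HB.instance Definition _ := GRing.ComUnitRing_isIntegral.Build Q Qintegral.


Lemma field_of_prime : exists (K : fieldType) (psi : {rmorphism R -> K}),
  forall a, p a <-> psi a = 0.
Proof.
pose Qd : idomainType := Q.
pose pi : {rmorphism R -> Qd} := \pi_({ideal_quot primeI})%qT.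
exists {fraction Qd}, (@tofrac Qd \o pi) => a /=.
have -> : p a <-> pi a = 0.
  have -> : p a <-> a \in primeI by rewrite -(asboolE (p a)).
  by rewrite -[a in a \in _]subr0 Quotient.idealrBE -(rmorph0 pi); split=> /eqP.
by split=> [->|/eqP]; [rewrite tofrac0 | rewrite tofrac_eq0 => /eqP].
Qed.

End PrimeQuotient.

Lemma exists_residue_field (R : comNzRingType) (J M : set R) :
  is_ideal J -> is_multiplicative M -> J `&` M = set0 ->
  exists (K : fieldType) (psi : {rmorphism R -> K}),
    (forall a, J a -> psi a = 0) /\ (forall a, M a -> psi a != 0).
Proof.
move=> Jid Mm JM0; have [p [pid Jp pM0 pp]] := exists_prime Jid Mm JM0.
have Mp a : M a -> ~ p a.
  by move=> Ma pa; move: (conj pa Ma : (p `&` M) a); rewrite pM0.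
have [K [psi psiP]] := field_of_prime pid (Mp 1 Mm.1) pp.
by exists K, psi; split=> a; [move=> /Jp/psiP | move=> /Mp na; apply/eqP => /psiP].
Qed.

(** * Generic extension of specializations and the Nullstellensatz *)

Section GenericExtension.
Context (R : comNzRingType) (K : fieldType) (f : {rmorphism R -> K}) (b : K).
Local Notation "p ^f" := (map_poly f p) : ring_scope.

(** The coefficients beyond the size of [p^f] are all killed by [f]. Cutting them off leaves a
    leading coefficient that [f] does not kill, as pseudo-division requires. *)
Lemma map_poly_truncate (p : {poly R}) : p^f != 0 ->
  exists q : {poly R}, [/\ q^f = p^f, f (lead_coef q) != 0 & size q = size p^f].
Proof.
move=> p0; pose q := \poly_(i < size p^f) p`_i.
have lp : f p`_(size p^f).-1 = lead_coef p^f by rewrite -coef_map.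
have sq : size q = size p^f.
  rewrite size_poly_eq //; apply: contra_neq p0 => lp0.
  by apply/eqP; rewrite -lead_coef_eq0 -lp lp0 rmorph0.
exists q; split=> //.
  apply/polyP => i; rewrite !coef_map coef_poly; case: ltnP => // ip.
  by rewrite raddf0 -(coef_map f) (nth_default _ ip).
rewrite lead_coefE sq coef_poly prednK ?size_poly_gt0 // leqnn.
by rewrite lp lead_coef_eq0.
Qed.

(** Plays the minimal polynomial of [b] over the fraction field of [f(R)], with denominators
    cleared: the coefficients are in [R], and the leading one need not be invertible. *)
Lemma min_annihilator (G : {poly R}) : G^f != 0 -> root G^f b ->
  exists G : {poly R}, [/\ f (lead_coef G) != 0, size G = size G^f, root G^f b &
    forall p : {poly R}, root p^f b -> (size p^f < size G)%N -> p^f = 0].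
Proof.
move=> G0 Gb.
pose Q k := `[< exists p : {poly R}, [/\ p^f != 0, root p^f b & size p^f = k] >].
have exQ : exists k, Q k by exists (size G^f); apply/asboolP; exists G.
have [k /asboolP[p [p0 pb sp]] kmin] := ex_minnP exQ.
have [q [qp lq sq]] := map_poly_truncate p0.
exists q; split=> //; [by rewrite qp| by rewrite qp |] => r rb.
rewrite sq sp ltnNge; apply: contraNeq => r0.
by apply: kmin; apply/asboolP; exists r.
Qed.

(** As [b] is algebraic over the fraction field of [f(R)], the inverse of [h(b)] is a polynomial in
    [b]; [r] clears its denominators. *)
Lemma inv_mod_annihilator (G h : {poly R}) :
  G^f != 0 -> root G^f b -> h^f.[b] != 0 ->
  exists (V : {poly R}) (r : R), f r != 0 /\ f r = V^f.[b] * h^f.[b].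
Proof.
move=> G0 Gb; have {G0 Gb}[{}G [lG sG /rootP Gb Gmin]] := min_annihilator G0 Gb.
have G0 : G^f != 0.
  by rewrite -size_poly_eq0 -sG size_poly_eq0; apply: contraNneq lG => ->;
    rewrite lead_coef0 rmorph0.
(* Euclid's algorithm on [G] and [h]: the remainder of [G] by [h] takes at [b]
   the value [- Q(b) h(b)], with [Q] the quotient. *)
have red n : forall h, (size h^f <= n)%N -> (size h^f < size G)%N ->
    h^f.[b] != 0 ->
    exists (V : {poly R}) (r : R), f r != 0 /\ f r = V^f.[b] * h^f.[b].
  elim: n => [|n IHn] {}h.
    by rewrite leqn0 size_poly_eq0 => /eqP->; rewrite horner0 eqxx.
  move=> hn hG hb.
  have h0 : h^f != 0 by apply: contraNneq hb => ->; rewrite horner0.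
  have [h' [h'h lh' sh']] := map_poly_truncate h0.
  rewrite -{}h'h in hn hG hb h0 sh' *.
  have [h1|h1] := leqP (size h'^f) 1.
    rewrite -sh' in h1; rewrite [h']size1_polyC // in hb *.
    exists 1, h'`_0; move: hb; rewrite map_polyC hornerC /= => hb.
    by rewrite rmorph1 hornerC mul1r.
  pose k := Pdiv.Ring.rscalp G h'; pose Qt := Pdiv.Ring.rdivp G h'.
  pose rho := Pdiv.Ring.rmodp G h'.
  have h'0 : h' != 0 by apply: contraNneq h0 => ->; rewrite rmorph0.
  have srho : (size rho < size h')%N by rewrite Pdiv.Ring.ltn_rmodp.
  have srhof : (size rho^f < size h'^f)%N.
    by rewrite -sh'; apply: leq_ltn_trans srho; apply: size_poly.
  have /(congr1 (map_poly f)) := Pdiv.ComRing.rdivp_eq h' G.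
  rewrite -/k -/Qt -/rho linearZ /= rmorphD rmorphM /= => e.
  have eb : Qt^f.[b] * h'^f.[b] = - rho^f.[b].
    apply/eqP; rewrite -subr_eq0 opprK -hornerM -hornerD -e hornerZ Gb.
    by rewrite mulr0.
  (* If the remainder vanished at [b], it would be 0 by minimality of [G]. Then [Qt] would vanish at
     [b] and be shorter than [G], as [h'] is not constant; so [Qt] would be 0 too, although [G] is
     not. *)
  have rhob : rho^f.[b] != 0.
    apply/eqP => rb0; move: eb; rewrite rb0 oppr0 => /eqP.
    rewrite mulf_eq0 (negbTE hb) orbF => Qb.
    have rho0 : rho^f = 0.
      apply: Gmin; first exact/rootP.
      exact: ltn_trans srhof hG.
    have Qh : Qt^f * h'^f != 0.
      by move: e; rewrite rho0 addr0 => <-; rewrite scaler_eq0 negb_or G0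
        rmorphXn expf_neq0.
    have : Qt^f = 0.
      apply: Gmin; first exact: Qb.
      have := congr1 (fun q : {poly K} => size q) e; rewrite rho0 addr0 size_scale; last first.
        by rewrite rmorphXn expf_neq0.
      have := Qh; rewrite mulf_eq0 negb_or => /andP[Q0 _].
      rewrite size_mul // sG => ->.
      move: h1; case: (size h'^f) => // -[//|m] _.
      by rewrite addnS /= addnS ltnS leq_addr.
    by move=> Q0; rewrite Q0 mul0r eqxx in Qh.
  have [||V [r [r0 rV]]] := IHn rho _ _ rhob.
  - by rewrite -ltnS (leq_trans srhof).
  - exact: ltn_trans srhof hG.
  exists (- V * Qt), r; split=> //.
  by rewrite rV rmorphM rmorphN hornerM hornerN -mulrA eb mulrNN.
(* A first division by [G] brings the size below that of [G], at the cost of a power of the leading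
   coefficient. *)
move=> hb; pose k := Pdiv.Ring.rscalp h G; pose Qt := Pdiv.Ring.rdivp h G.
pose rho := Pdiv.Ring.rmodp h G.
have G'0 : G != 0 by apply: contraNneq G0 => ->; rewrite rmorph0.
have srho : (size rho < size G)%N by rewrite Pdiv.Ring.ltn_rmodp.
have /(congr1 (map_poly f)) := Pdiv.ComRing.rdivp_eq G h.
rewrite -/k -/Qt -/rho linearZ /= rmorphD rmorphM /= => e.
have rhob : rho^f.[b] = f (lead_coef G ^+ k) * h^f.[b].
  by rewrite -hornerZ e hornerD hornerM Gb mulr0 add0r.
have [|||V [r [r0 rV]]] := red (size rho^f) rho.
- exact: leqnn.
- by apply: leq_ltn_trans srho; apply: size_poly.
- by rewrite rhob mulf_neq0 // rmorphXn expf_neq0.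
exists (V * (lead_coef G ^+ k)%:P), r; split=> //.
by rewrite rV rhob rmorphM /= map_polyC hornerM hornerC mulrA.
Qed.

(* A point [g] of [R] at which [s] does not vanish extends to a point of [R[b]]
   at which [h(b)] does not vanish. *)
Lemma generic_extension1 (F : closedFieldType) (h : {poly R}) : h^f.[b] != 0 ->
  exists s : R, f s != 0 /\ forall g : {rmorphism R -> F},
    (forall r, f r = 0 -> g r = 0) -> g s != 0 ->
    exists c, (forall p : {poly R}, p^f.[b] = 0 -> (map_poly g p).[c] = 0) /\
      (map_poly g h).[c] != 0.
Proof.
move=> hb.
have f_g0 (g : {rmorphism R -> F}) : (forall r, f r = 0 -> g r = 0) ->
    forall p : {poly R}, p^f = 0 -> map_poly g p = 0.
  move=> fg p p0; apply/polyP => i; rewrite coef_map coef0 /=; apply: fg.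
  by rewrite -coef_map p0 coef0.
have [[G0 [G00 G0b]]|trans] :=
    pselect (exists G : {poly R}, G^f != 0 /\ root G^f b); last first.
  (* Transcendental case: a polynomial that vanishes at [b] has image 0 under [f], hence under [g],
     so any nonroot [c] of the image of [h] works. *)
  have h0 : h^f != 0 by apply: contraNneq hb => ->; rewrite horner0.
  have [h' [h'h lh' sh']] := map_poly_truncate h0.
  exists (lead_coef h'); split=> // g fg gs.
  have hh' : map_poly g h = map_poly g h'.
    by apply/eqP; rewrite -subr_eq0 -rmorphB; apply/eqP/f_g0 => //;
      rewrite rmorphB /= h'h subrr.
  have /closed_nonrootP[c hc] : map_poly g h != 0.
    apply: contraNneq gs => gh0.
    by rewrite lead_coefE -coef_map -hh' gh0 coef0.
  exists c; split=> // p /rootP pb.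
  rewrite f_g0 ?horner0 //; apply/eqP; apply/negPn/negP => p0.
  by apply: trans; exists p.
have [V [r [r0 rV]]] := inv_mod_annihilator G00 G0b hb.
have [G [lG sG /rootP Gb Gmin]] := min_annihilator G00 G0b.
(* [lead_coef G] keeps the image of [G] nonconstant, so that it has a root [c], and allows
   pseudo-division by [G]; [r] keeps the value of [h] at [c] nonzero. *)
exists (r * lead_coef G); split; first by rewrite rmorphM mulf_neq0.
move=> g fg; rewrite rmorphM mulf_eq0 negb_or => /andP[gr gl].
have sgG : size (map_poly g G) = size G by rewrite size_map_poly_id0.
have /closed_rootP[c /rootP Gc] : size (map_poly g G) != 1%N.
  rewrite sgG; apply: contraNneq lG => s1; move: Gb.
  have /size_poly1P[a a0 ->] : size G == 1%N by rewrite s1.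
  by rewrite map_polyC hornerC lead_coefC /= => ->.
exists c.
have spec p : p^f.[b] = 0 -> (map_poly g p).[c] = 0.
  move=> pb; pose k := Pdiv.Ring.rscalp p G.
  pose Qt := Pdiv.Ring.rdivp p G; pose rho := Pdiv.Ring.rmodp p G.
  have G'0 : G != 0.
    by rewrite -lead_coef_eq0; apply: contraNneq lG => ->; rewrite rmorph0.
  have srho : (size rho < size G)%N by rewrite Pdiv.Ring.ltn_rmodp.
  have e := Pdiv.ComRing.rdivp_eq G p; rewrite -/k -/Qt -/rho in e.
  have rho0 : rho^f = 0.
    apply: Gmin; last by apply: leq_ltn_trans srho; apply: size_poly.
    apply/rootP; have /(congr1 (fun q => q^f.[b])) := e.
    by rewrite linearZ rmorphD rmorphM /= hornerZ hornerD hornerM pb Gb !mulr0 add0r.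
  have /(congr1 (fun q => (map_poly g q).[c])) := e.
  rewrite linearZ rmorphD rmorphM /= hornerZ hornerD hornerM Gc (f_g0 _ fg _ rho0).
  rewrite mulr0 horner0 addr0 => /eqP; rewrite mulf_eq0 rmorphXn => /orP[|/eqP//].
  by rewrite expf_eq0 (negbTE gl) andbF.
split=> //; have := spec (r%:P - V * h).
rewrite !rmorphB !rmorphM /= !map_polyC !hornerE /= rV subrr => /(_ erefl)/eqP.
by rewrite subr_eq0 => /eqP gre; apply: contraNneq gr => h0; rewrite gre h0 mulr0.
Qed.

End GenericExtension.

Section GenericExtensionMpoly.
Context (R : comNzRingType) (K : fieldType) (F : closedFieldType).
Context (f : {rmorphism R -> K}).

(** The coordinates are extended one at a time: the element [s'] that must not vanish for the last
    one is the polynomial [H] imposed on the preceding ones. *)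
Lemma generic_extension n (x : 'I_n -> K) (H : mpoly n R) : mmap f x H != 0 ->
  exists s : R, f s != 0 /\ forall g : {rmorphism R -> F},
    (forall r, f r = 0 -> g r = 0) -> g s != 0 ->
    exists y : 'I_n -> F,
      (forall p : mpoly n R, mmap f x p = 0 -> mmap g y p = 0) /\
      mmap g y H != 0.
Proof.
elim: n x H => [|n IHn] x H Hx.
  exists (mcoeff mnm0 H); split.
    by move: Hx; rewrite [H]mpoly0E mmapC mcoeffC eqxx mulr1.
  move=> g fg gH; exists (fun=> 0); split=> [p|].
    by rewrite [p]mpoly0E !mmapC; apply: fg.
  by rewrite [H]mpoly0E mmapC.
rewrite mmap_muni in Hx.
have [s' [fs' ext1]] := generic_extension1 F Hx.
have [s [fs ext]] := IHn _ _ fs'.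
exists s; split=> // g fg gs; have [y [ypec ys']] := ext g fg gs.
have [c [cspec cH]] := ext1 _ ypec ys'.
exists (ord_rcons y c).
rewrite mmap_muni ord_rcons_max ord_rcons_widen; split=> // p.
by rewrite !mmap_muni ord_rcons_max ord_rcons_widen; apply: cspec.
Qed.

End GenericExtensionMpoly.

Lemma mmapE_rmorph n (R S : comNzRingType) (f : {rmorphism mpoly n R -> S}) p :
  f p = mmap (f \o @mpolyC n R) (fun i => f (mpolyX R (mnm1 i))) p.
Proof.
pose g : {rmorphism mpoly n R -> S} :=
  mmap (f \o @mpolyC n R) (fun i => f (mpolyX R (mnm1 i))).
rewrite -[RHS]/(g p); move: p; apply: mpoly_rmorph_eq => [c|i]; rewrite /g /=.
  by rewrite mmapC.
by rewrite mmapX mmap1U.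
Qed.

(** A prime that contains [J] and no power of [h] gives a zero of [J] in a field over [F];
    [generic_extension], with base ring [F] and [g] the identity, brings it down to [F]. *)
Lemma nullstellensatz (F : closedFieldType) n (J : set (mpoly n F)) h :
  is_ideal J -> (forall k, ~ J (h ^+ k)) ->
  exists v, (forall p, J p -> meval v p = 0) /\ meval v h != 0.
Proof.
move=> Jid Jh.
have [||K [psi [psiJ psih]]] := exists_residue_field (M := [set h ^+ k | k in setT]) Jid.
- split; first by exists 0%N; rewrite ?expr0.
  by move=> a b [k _ <-] [l _ <-]; exists (k + l)%N; rewrite ?exprD.
- by rewrite -subset0 => a [Jk [k _ kE]]; apply: (Jh k); rewrite kE.
have psi0 : mmap (psi \o @mpolyC n F) (fun i => psi (mpolyX F (mnm1 i))) h != 0.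
  by rewrite -mmapE_rmorph; apply: psih; exists 1%N.
have [s [fs ext]] := generic_extension F psi0.
have [||v [vspec vh]] := ext idfun.
- by move=> r /eqP; rewrite fmorph_eq0 => /eqP.
- by apply: contraNneq fs => /= ->; rewrite rmorph0.
exists v; split=> // p /psiJ p0; apply: vspec.
by rewrite -mmapE_rmorph.
Qed.

Lemma weak_nullstellensatz (F : closedFieldType) n (J : set (mpoly n F)) :
  is_ideal J -> ~ J 1 -> exists v, forall p, J p -> meval v p = 0.
Proof.
move=> Jid J1; have [|v [vJ _]] := @nullstellensatz F n J 1 Jid.
  by move=> k; rewrite expr1n.
by exists v.
Qed.

(** * Integrally closed domains and minimal polynomials *)

(* The integral equation of a / q, with denominators cleared. *)
Definition frac_integral (T : comNzRingType) (a q : T) : Prop :=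
  exists (m : nat) (c : nat -> T),
    a ^+ m + \sum_(i < m) c i * (a ^+ i * q ^+ (m - i)) = 0.

Definition int_closed (T : idomainType) : Prop :=
  forall a q : T, q != 0 -> frac_integral a q -> exists b, a = b * q.

Lemma frac_integral_morph (T S : comNzRingType) (f : {rmorphism T -> S}) a q :
  frac_integral a q -> frac_integral (f a) (f q).
Proof.
move=> [m [c /(congr1 f)]]; rewrite rmorphD rmorph_sum rmorphXn rmorph0 => e.
exists m, (f \o c); rewrite -[RHS]e; congr (_ + _); apply: eq_bigr => i _.
by rewrite !rmorphM !rmorphXn.
Qed.

Lemma frac_integral_cancel (T : idomainType) (g a q : T) : g != 0 ->
  frac_integral (a * g) (q * g) -> frac_integral a q.
Proof.
move=> g0 [m [c e]]; exists m, c; apply: (@mulfI _ (g ^+ m)).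
  by rewrite expf_neq0.
rewrite mulr0 -[RHS]e exprMn mulrDr mulrC mulr_sumr; congr (_ + _).
apply: eq_bigr => i _; rewrite !exprMn.
have -> : g ^+ m = g ^+ i * g ^+ (m - i) by rewrite -exprD subnKC // ltnW.
by ring.
Qed.

Lemma mul_div_cancel (E : fieldType) (a b c d : E) :
  b != 0 -> c * (a / b) * (b * d) = c * (a * d).
Proof. by move=> b0; field. Qed.

Lemma frac_integral_root (T : comNzRingType) (E : fieldType)
    (f : {rmorphism T -> E}) (p : {poly T}) (a q : T) :
  injective f -> p \is monic -> f q != 0 ->
  root (map_poly f p) (f a / f q) -> frac_integral a q.
Proof.
move=> f_inj pm q0 /rootP; rewrite horner_coef size_map_poly_id0; last first.
  by rewrite (monicP pm) rmorph1 oner_eq0.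
have sp : (0 < size p)%N by rewrite size_poly_gt0 monic_neq0.
rewrite -(prednK sp) big_ord_recr /= coef_map /= -lead_coefE (monicP pm) rmorph1 mul1r.
set m := (size p).-1 => e; exists m, (fun i => p`_i); apply: f_inj.
rewrite rmorph0 rmorphD rmorph_sum rmorphXn addrC.
transitivity (f q ^+ m * 0); last by rewrite mulr0.
rewrite -[X in _ * X]e mulrDr expr_div_n mulrCA mulrV ?unitfE ?expf_neq0 //.
rewrite mulr1 mulr_sumr; congr (_ + _); apply: eq_bigr => i _.
rewrite !rmorphM !rmorphXn coef_map /= expr_div_n.
have -> : f q ^+ m = f q ^+ (m - i) * f q ^+ i by rewrite -exprD subnK // ltnW.
have qi0 : f q ^+ i != 0 by rewrite expf_neq0.
by field.
Qed.

Lemma fraction_inj (T : idomainType) : injective (@tofrac T).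
Proof. by move=> x y /eqP; rewrite tofrac_eq => /eqP. Qed.

Lemma fractionE (T : idomainType) (z : {fraction T}) :
  exists a q : T, q != 0 /\ z = tofrac a / tofrac q.
Proof.
elim/quotW: z => r; exists (frac r).1, (frac r).2; split; first exact: denom_ratioP.
apply: (canRL (mulfK _)); first by rewrite tofrac_eq0 denom_ratioP.
unlock FracField.tofrac; rewrite -[LHS]FracField.pi_mul.
apply/eqP; rewrite FracField.equivf_def /=.
by rewrite !numden_Ratio ?mulr1 ?oner_eq0 ?denom_ratioP // mulrC.
Qed.

(** The rational root argument: once divided by their gcd, the denominator divides a power of the
    numerator and is therefore a unit. *)
Lemma int_closed_poly_field (k : fieldType) : int_closed {poly k}.
Proof.
move=> a q q0; set g := gcdp a q.
have g0 : g != 0 by rewrite gcdp_eq0 (negbTE q0) andbF.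
have -> : frac_integral a q = frac_integral (a %/ g * g) (q %/ g * g).
  by rewrite !divpK ?dvdp_gcdl ?dvdp_gcdr.
move=> /(frac_integral_cancel g0)[m [c e]].
have cop : coprimep (a %/ g) (q %/ g) by rewrite coprimep_div_gcd // q0 orbT.
have dv : (q %/ g) %| (a %/ g) ^+ m.
  move/eqP: e; rewrite addr_eq0 => /eqP ->; rewrite dvdpNr.
  apply: (big_ind (fun x => q %/ g %| x)) => [|x y|i _]; first exact: dvdp0.
    exact: dvdp_add.
  by rewrite !dvdp_mull // -(subnSK (ltn_ord i)) exprS dvdp_mulr.
have : coprimep (q %/ g) (q %/ g).
  by apply: (coprimep_dvdr dv); rewrite coprimep_expl.
rewrite coprimepp => /size_poly1P[r r0 qE].
exists (r^-1 *: (a %/ g)); rewrite -[in RHS](divpK (dvdp_gcdr a q)) -/g qE.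
rewrite -scalerAl mulrCA divpK ?dvdp_gcdl // mul_polyC scalerA.
by rewrite mulVf // scale1r.
Qed.

Section PolyIntClosed.
Context (C : fieldType) (e : nat -> C) (e_inj : injective e).
Context (T : idomainType) (iota : {rmorphism C -> T}).
Hypothesis T_closed : int_closed T.
Local Notation k := {fraction T}.
Local Notation frac := (@tofrac T).

(* Newton interpolation: the quotients by the [X - e n] again take values in [T]. *)
Lemma coefs_from_values (b : {poly k}) n :
  (forall i, (n <= i)%N -> exists t, b.[frac (iota (e i))] = frac t) ->
  forall j, exists t, b`_j = frac t.
Proof.
have [m] := ubnP (size b); elim: m b n => // m IHm b n.
rewrite ltnS => bm bv; have [t bt] := bv n (leqnn n).
pose c := frac (iota (e n)).
have /factor_theorem[b1 b1E] : root (b - (frac t)%:P) c.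
  by rewrite /root !hornerE bt subrr.
have {b1E} bE : b = b1 * ('X - c%:P) + (frac t)%:P by rewrite -b1E subrK.
have [b0|b0] := eqVneq b1 0.
  move=> j; rewrite bE b0 mul0r add0r coefC.
  by case: eqP => _; [exists t | exists 0; rewrite rmorph0].
have sb : size b = (size b1).+1.
  rewrite bE size_polyDl ?size_Mmonic ?monicXsubC // size_XsubC ?addn2 //.
  by rewrite (leq_ltn_trans (size_polyC_leq1 _)) // ltnS size_poly_gt0.
have IH : forall j, exists t, b1`_j = frac t.
  apply: (IHm b1 n.+1) => [|i ni]; first by rewrite -sb.
  have [t' bt'] := bv i (ltnW ni); have cn : e i - e n != 0.
    by rewrite subr_eq0 (inj_eq e_inj) gtn_eqF.
  have ie : iota (e i - e n)^-1 * iota (e i - e n) = 1.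
    by rewrite -rmorphM mulVf ?rmorph1.
  exists (iota (e i - e n)^-1 * (t' - t)).
  have : frac (t' - t) = b1.[frac (iota (e i))] * frac (iota (e i - e n)).
    have -> : frac (t' - t) = b.[frac (iota (e i))] - frac t.
      by rewrite tofracB bt'.
    have -> : frac (iota (e i - e n)) = frac (iota (e i)) - c by rewrite !rmorphB.
    by rewrite bE !hornerE /=; ring.
  move=> te; rewrite [RHS]tofracM te.
  by rewrite mulrCA -tofracM ie tofrac1 mulr1.
move=> j; rewrite bE mulrBr coefD coefB coefMX coefMC coefC.
have [t1 ->] := IH j; have [t2 ->] := IH j.-1.
exists ((if j == 0%N then 0 else t2) - t1 * iota (e n) + (if j == 0%N then t else 0)).
by rewrite tofracD tofracB tofracM; case: eqP; rewrite ?tofrac0.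
Qed.

(** Over the fraction field of [T], [a / q] is a polynomial [b]. The integral equation of [b]
    evaluates to integral equations of its values at the scalars [iota (e i)], which are thus in
    [T], and [coefs_from_values] passes from values to coefficients. *)
Lemma int_closed_poly : int_closed {poly T}.
Proof.
move=> a q q0 int_aq.
pose F : {rmorphism {poly T} -> {poly k}} := map_poly frac.
have F_inj : injective F by apply: map_inj_poly (tofrac0 _); apply: fraction_inj.
have [b aE] : exists b, F a = b * F q.
  apply: int_closed_poly_field; last exact: frac_integral_morph.
  by rewrite (raddf_eq0 _ F_inj).
have [m [c mc]] := int_aq.
have Fq0 : F q != 0 by rewrite (raddf_eq0 _ F_inj).
have bint : b ^+ m + \sum_(i < m) F (c i) * b ^+ i = 0.
  apply: (@mulIf _ (F q ^+ m)); first by rewrite expf_neq0.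
  rewrite mul0r; apply: etrans (etrans (congr1 F mc) (rmorph0 F)).
  rewrite rmorphD rmorph_sum rmorphXn aE exprMn mulrDl.
  congr (_ + _); rewrite mulr_suml; apply: eq_bigr => i _.
  rewrite !rmorphM !rmorphXn aE exprMn -!mulrA; congr (_ * (_ * _)).
  by rewrite -exprD subnKC // ltnW.
have coefs : forall j, exists t, b`_j = frac t.
  apply: (@coefs_from_values _ 0%N) => i _.
  have [al [be [be0 vE]]] := fractionE b.[frac (iota (e i))].
  suff [t tE] : exists t, al = t * be.
    by exists t; rewrite vE tE rmorphM mulfK // tofrac_eq0.
  apply: T_closed => //; exists m, (fun j => (c j).[iota (e i)]).
  apply: fraction_inj; rewrite rmorph0 rmorphD rmorph_sum rmorphXn.
  have := congr1 (fun p => p.[frac (iota (e i))] * frac be ^+ m) bint.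
  rewrite /= horner0 mul0r; apply: etrans; rewrite hornerD mulrDl horner_exp vE.
  have fbe0 : frac be != 0 by rewrite tofrac_eq0.
  rewrite -exprMn divfK //; congr (_ + _).
  rewrite horner_sum mulr_suml; apply: eq_bigr => j _.
  rewrite hornerM horner_exp horner_map vE !rmorphM !rmorphXn /= expr_div_n.
  have -> : frac be ^+ m = frac be ^+ j * frac be ^+ (m - j).
    by rewrite -exprD subnKC // ltnW.
  by apply/esym/mul_div_cancel; rewrite expf_neq0.
have [g gE] := choice coefs.
exists (\poly_(i < size b) g i); apply: F_inj; rewrite rmorphM aE; congr (_ * _).
apply/polyP => j; rewrite coef_map coef_poly; case: ltnP => jb; first exact: gE.
by rewrite raddf0 nth_default.
Qed.

End PolyIntClosed.

Lemma int_closed_mpoly (C : fieldType) (e : nat -> C) n :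
  injective e -> int_closed (mpoly n C).
Proof.
move=> e_inj; elim: n => [|n IHn] a q q0 aq.
  have c0 : mcoeff mnm0 q != 0.
    by apply: contraNneq q0 => c0; rewrite [q]mpoly0E c0 mpolyC0.
  exists (a * mpolyC 0 (mcoeff mnm0 q)^-1); rewrite {2}[q]mpoly0E -mulrA -mpolyCM.
  by rewrite mulVf // mpolyC1 mulr1.
have [b bE] : exists b, muni a = b * muni q.
  apply: (int_closed_poly e_inj (@mpolyC n C : {rmorphism C -> _}) IHn).
    by rewrite -(raddf_eq0 _ (can_inj (@muniK n C))) in q0.
  exact: frac_integral_morph.
by exists (mfold n C b); rewrite -[a]muniK bE rmorphM muniK.
Qed.

Lemma exists_irreducible_factor (k : fieldType) (p : {poly k}) :
  (1 < size p)%N -> exists2 g, irreducible_poly g & g %| p.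
Proof.
move=> p1.
pose Q n := `[< exists g : {poly k}, [/\ (1 < size g)%N, g %| p & size g = n] >].
have exQ : exists n, Q n by exists (size p); apply/asboolP; exists p.
have [n /asboolP[g [g1 gp sg]] nmin] := ex_minnP exQ.
exists g => //; split=> // q q1 qg.
have q0 : q != 0.
  by apply: contraTneq qg => ->; rewrite dvd0p -size_poly_eq0 -lt0n ltnW.
rewrite -dvdp_size_eqp // eqn_leq dvdp_leq -?size_poly_gt0 ?(ltnW g1) //= sg.
apply: nmin; apply/asboolP; exists q; split=> //; last exact: dvdp_trans gp.
by rewrite ltn_neqAle eq_sym q1 size_poly_gt0.
Qed.

Lemma splitting_extension (k : fieldType) (p : {poly k}) : p != 0 ->
  exists (L : fieldType) (f : {rmorphism k -> L}) (rs : seq L),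
    map_poly f p %= \prod_(r <- rs) ('X - r%:P).
Proof.
have [n] := ubnP (size p); elim: n k p => // n IHn k p; rewrite ltnS => pn p0.
have [p1|p1] := leqP (size p) 1.
  exists k, idfun, [::]; rewrite big_nil (map_poly_id (fun _ _ => erefl)) -size_poly_eq1.
  by rewrite eqn_leq p1 size_poly_gt0.
have [g girr gp] := exists_irreducible_factor p1.
have [L _ [z gz _]] := irredp_FAdjoin girr.
pose f : {rmorphism k -> L} := in_alg L.
have : root (map_poly f p) z.
  rewrite -dvdp_XsubCl; apply: dvdp_trans (_ : map_poly f g %| _).
    by rewrite dvdp_XsubCl.
  by rewrite dvdp_map.
move=> /factor_theorem[p' p'E].
have p'0 : p' != 0.
  by apply: contraNneq p0 => p'0; rewrite -(map_poly_eq0 f) p'E p'0 mul0r.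
have [|L' [f' [rs rsE]]] := IHn L p' _ p'0.
  apply: leq_trans pn; rewrite -(size_map_poly f) p'E.
  by rewrite size_Mmonic ?monicXsubC // size_XsubC addn2.
exists L', (f' \o f), (f' z :: rs).
rewrite map_poly_comp p'E rmorphM /= map_polyXsubC big_cons mulrC.
by rewrite eqp_mull.
Qed.

Section IntegralProducts.
Context (T : comNzRingType) (E : fieldType) (f : {rmorphism T -> E}).

Lemma integralOver_sum (I : Type) (s : seq I) (F : I -> E) :
  (forall i, integralOver f (F i)) -> integralOver f (\sum_(i <- s) F i).
Proof.
move=> hF; apply: big_ind => //; [exact: mxpoly.integral0|exact: integral_add].
Qed.

Lemma integral_prod_XsubC (rs : seq E) : {in rs, integralRange f} ->
  forall i, integralOver f (\prod_(r <- rs) ('X - r%:P))`_i.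
Proof.
elim: rs => [|r rs IHrs] rsT i.
  by rewrite big_nil coef1; apply: integral_nat.
have IH : forall j, integralOver f (\prod_(r <- rs) ('X - r%:P))`_j.
  by apply: IHrs => x xs; apply: rsT; rewrite inE xs orbT.
rewrite big_cons mulrBl coefB coefXM coefCM; apply: integral_sub.
  by case: eqP => _; [exact: mxpoly.integral0 | exact: IH].
by apply: integral_mul => //; apply: rsT; rewrite mem_head.
Qed.

End IntegralProducts.

(** The minimal polynomial [g] of [u] over the fraction field of [T] divides the integral equation
    [M], so its roots are integral over [T]. Its coefficients are polynomials in these roots, hence
    integral, hence in [T]. Monic division does the rest. *)
Lemma monic_minpoly (T : idomainType) (K : fieldType) (f : {rmorphism T -> K}) u :
  int_closed T -> injective f -> integralOver f u ->
  exists P : {poly T}, [/\ P \is monic, root (map_poly f P) u &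
    forall G : {poly T}, root (map_poly f G) u -> exists H, G = H * P].
Proof.
move=> T_closed f_inj [M Mmon Mu].
have F_inj : injective (map_poly f) by apply: map_inj_poly f_inj (rmorph0 _).
have M0 : map_poly f M != 0 by rewrite (raddf_eq0 _ F_inj) monic_neq0.
have [G [lG sG Gu Gmin]] := min_annihilator M0 Mu.
have Gmin' (p : {poly T}) : root (map_poly f p) u -> (size p < size G)%N -> p = 0.
  move=> pu pG; apply: F_inj; rewrite rmorph0; apply: Gmin => //.
  by apply: leq_ltn_trans pG; apply: size_poly.
have G0 : G != 0 by apply: contraNneq lG => ->; rewrite lead_coef0 rmorph0.
have lG0 : lead_coef G != 0 by rewrite lead_coef_eq0.
pose frac := @tofrac T; pose Mk := map_poly frac M; pose Gk := map_poly frac G.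
have lk0 : frac (lead_coef G) != 0 by rewrite tofrac_eq0.
have Fr_inj : injective (map_poly frac).
  exact: map_inj_poly (@fraction_inj T) (tofrac0 T).
have Mk0 : Mk != 0.
  apply: contraNneq (monic_neq0 Mmon) => Mk0; apply/eqP/Fr_inj.
  by rewrite rmorph0.
have GM : Gk %| Mk.
  pose r := Pdiv.Ring.rmodp M G; have e := Pdiv.ComRing.rdivp_eq G M; rewrite -/r in e.
  have r0 : r = 0.
    apply: Gmin'; last by rewrite Pdiv.Ring.ltn_rmodp.
    apply/rootP; have := congr1 (fun p => (map_poly f p).[u]) e.
    rewrite /= linearZ rmorphD rmorphM /= hornerZ hornerD hornerM (rootP Mu) (rootP Gu).
    by rewrite !mulr0 add0r.
  have := congr1 (map_poly frac) e; rewrite r0 addr0 linearZ rmorphM /= => ek.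
  rewrite -(@dvdpZr _ (frac (lead_coef G ^+ Pdiv.Ring.rscalp M G))).
    by rewrite ek dvdp_mull.
  by rewrite /frac tofracXn expf_neq0.
have [L [h [rs Mrs]]] := splitting_extension Mk0.
pose hf : {rmorphism T -> L} := h \o frac.
have rs_int : {in rs, integralRange hf}.
  move=> r rrs; exists M => //; rewrite /hf map_poly_comp /= -/Mk.
  by rewrite (eqp_root Mrs) root_prod_XsubC.
have GL : map_poly h Gk %| \prod_(r <- rs) ('X - r%:P).
  by rewrite -(eqp_dvdr _ Mrs) dvdp_map.
have [m Gm] := dvdp_prod_XsubC GL.
pose g := (frac (lead_coef G))^-1 *: Gk.
have gmon : g \is monic.
  by rewrite monicE lead_coefZ lead_coef_map_inj ?rmorph0 ?mulVf //; apply: fraction_inj.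
have gL : map_poly h g = \prod_(r <- mask m rs) ('X - r%:P).
  apply/eqP; rewrite -eqp_monic ?monic_map ?monic_prod_XsubC //.
  by apply: eqp_trans Gm; rewrite linearZ eqp_scale // fmorph_eq0 invr_eq0.
have coefs i : exists t, g`_i = frac t.
  have [al [be [be0 gE]]] := fractionE g`_i.
  suff [t tE] : exists t, al = t * be.
    by exists t; rewrite gE tE tofracM mulfK // tofrac_eq0.
  apply: T_closed => //.
  have : integralOver hf (map_poly h g)`_i.
    by rewrite gL; apply: integral_prod_XsubC => r /mem_mask; apply: rs_int.
  rewrite coef_map gE => -[p pmon]; rewrite /hf map_poly_comp fmorph_root => proot.
  by apply: frac_integral_root pmon _ proot; [exact: fraction_inj | rewrite tofrac_eq0].
have [c cE] := choice coefs.
pose P := \poly_(i < size g) c i.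
have PE : map_poly frac P = g.
  apply/polyP => j; rewrite coef_map coef_poly; case: ltnP => jb; first by rewrite cE.
  by rewrite raddf0 nth_default.
have Pmon : P \is monic.
  rewrite monicE; apply/eqP/fraction_inj; rewrite tofrac1 -(monicP gmon) -PE.
  by rewrite lead_coef_map_inj ?tofrac0 //; apply: fraction_inj.
have GP : G = lead_coef G *: P.
  apply: Fr_inj.
  by rewrite linearZ /= -/frac PE scalerA mulfV // scale1r.
have sP : size P = size G by rewrite {1}GP size_scale.
have Pu : root (map_poly f P) u.
  move: Gu; rewrite {1}GP linearZ /= /root hornerZ mulf_eq0.
  by rewrite (negbTE lG).
exists P; split=> // H Hu; have e := Pdiv.RingMonic.rdivp_eq Pmon H.
exists (Pdiv.Ring.rdivp H P); rewrite {1}e [Pdiv.Ring.rmodp H P]Gmin' ?addr0 //.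
  have := Hu; rewrite {1}e /root rmorphD rmorphM /= hornerD hornerM.
  by rewrite (rootP Pu) mulr0 add0r.
by rewrite -sP Pdiv.Ring.ltn_rmodp monic_neq0.
Qed.

(** * Noether normalization *)

Lemma poly_nonroot_seq (C : idomainType) (p : {poly C}) (z : nat -> C) :
  p != 0 -> injective z -> exists k, p.[z k] != 0.
Proof.
move=> p0 z_inj; apply: contrapT => /forallNP nz.
have := max_poly_roots p0 (_ : all (root p) (mkseq z (size p))) _.
rewrite size_mkseq ltnn => /(_ _ _)/negP; apply=> //.
  by apply/allP => _ /mapP[k _ ->]; apply/negPn/negP => h; apply: (nz k).
by rewrite mkseq_uniq.
Qed.

(** Each coordinate ranges over a prescribed infinite sequence: scalars for generic linear forms,
    points close to a given one in [nearby_nonzero]. *)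
Lemma mpoly_nonzero_value (C : idomainType) n (P : mpoly n C)
    (z : 'I_n -> nat -> C) : P != 0 -> (forall i, injective (z i)) ->
  exists k : 'I_n -> nat, meval (fun i => z i (k i)) P != 0.
Proof.
elim: n P z => [|n IHn] P z P0 z_inj.
  exists (fun=> 0%N); rewrite [P]mpoly0E mevalC.
  by apply: contraNneq P0 => c0; rewrite [P]mpoly0E c0 mpolyC0.
have uP0 : muni P != 0 by rewrite -(raddf_eq0 _ (can_inj (@muniK n C))) in P0.
rewrite -lead_coef_eq0 in uP0.
have [k' k'P] := IHn _ (fun i => z (widen_ord (leqnSn n) i)) uP0 (fun=> z_inj _).
set v' := (X in meval X) in k'P.
have p0 : map_poly (meval v') (muni P) != 0.
  apply: contraNneq k'P => p0.
  by rewrite lead_coefE -(coef_map (meval v')) p0 coef0.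
have [l lP] := poly_nonroot_seq p0 (z_inj ord_max).
exists (ord_rcons k' l); rewrite /meval mmap_muni ord_rcons_max /=.
rewrite (_ : _ \o _ = v') //; apply/funext => i; rewrite /v' /=.
by rewrite -[in k' i](ord_rcons_widen k' l).
Qed.

Section CoefIntegral.
Context (T : comNzRingType) (E : fieldType) (f : {rmorphism T -> E}).

Definition coefs_integral (p : {poly E}) := forall i, integralOver f p`_i.

Lemma coefs_integralD p q :
  coefs_integral p -> coefs_integral q -> coefs_integral (p + q).
Proof. by move=> hp hq i; rewrite coefD; apply: integral_add. Qed.

Lemma coefs_integralM p q :
  coefs_integral p -> coefs_integral q -> coefs_integral (p * q).
Proof.
by move=> hp hq i; rewrite coefM; apply: integralOver_sum => j; apply: integral_mul.
Qed.

Lemma coefs_integralC c : integralOver f c -> coefs_integral c%:P.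
Proof.
by move=> hc i; rewrite coefC; case: eqP => // _; apply: mxpoly.integral0.
Qed.

Lemma coefs_integralX : coefs_integral 'X.
Proof. by move=> i; rewrite coefX; apply: integral_nat. Qed.

Lemma coefs_integral_mmap (C : comNzRingType) n (g : {rmorphism C -> {poly E}})
    (y : 'I_n -> {poly E}) (P : mpoly n C) :
  (forall c, coefs_integral (g c)) -> (forall i, coefs_integral (y i)) ->
  coefs_integral (mmap g y P).
Proof.
move=> hg hy; elim/mpolyind: P => [|c m p _ _ IHp].
  by rewrite mmap0 => i; rewrite coef0; apply: mxpoly.integral0.
rewrite mmapD mmapZ mmapX; apply: (coefs_integralD _ IHp).
apply: coefs_integralM => //; rewrite /mmap1; apply: big_ind => //.
- by apply: coefs_integralC; apply: integral1.
- exact: coefs_integralM.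
move=> i _; elim: (m i) => [|k IHk].
  by rewrite expr0; apply: coefs_integralC; apply: integral1.
by rewrite exprS; apply: coefs_integralM.
Qed.

End CoefIntegral.

Section TopCoef.
Context (E : comNzRingType).

(** [l] may be 0, so that the property is multiplicative over any commutative ring. *)
Definition top_coef (d : nat) (l : E) (p : {poly E}) :=
  (size p <= d.+1)%N /\ p`_d = l.

Lemma top_coefM d1 l1 p1 d2 l2 p2 : top_coef d1 l1 p1 -> top_coef d2 l2 p2 ->
  top_coef (d1 + d2) (l1 * l2) (p1 * p2).
Proof.
move=> [s1 <-] [s2 <-]; split.
  by apply: leq_trans (size_polyMleq _ _) _; lia.
rewrite coefM (bigD1 (inord d1)) //= inordK ?ltnS ?leq_addr // addKn.
rewrite big1 ?addr0 // => i id1.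
have [ilt|ige] := ltnP i d1.
  by rewrite [p2`__]nth_default ?mulr0 //; apply: leq_trans s2 _; lia.
rewrite [p1`__]nth_default ?mul0r //; apply: leq_trans s1 _.
rewrite ltn_neqAle ige andbT; apply: contraNneq id1 => d1i.
by apply/eqP/val_inj; rewrite /= inordK ?ltnS ?leq_addr.
Qed.

Lemma top_coefX d l p k : top_coef d l p -> top_coef (d * k) (l ^+ k) (p ^+ k).
Proof.
move=> h; elim: k => [|k IHk].
  by rewrite muln0 !expr0 /top_coef size_poly1 coef1.
by rewrite mulnS !exprS; apply: top_coefM.
Qed.

Lemma top_coef_prod (I : Type) (s : seq I) (d : I -> nat) (l : I -> E) p :
  (forall i, top_coef (d i) (l i) (p i)) ->
  top_coef (\sum_(i <- s) d i) (\prod_(i <- s) l i) (\prod_(i <- s) p i).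
Proof.
move=> h; elim: s => [|i s IHs]; first by rewrite !big_nil /top_coef size_poly1 coef1.
by rewrite !big_cons; apply: top_coefM.
Qed.

End TopCoef.

(* In the coordinates [x' = x - l w] the relation [P] becomes a polynomial in [w]
   whose top coefficient is the value at [l] of the top form of [P]. *)
Lemma noether_step (C : fieldType) (e : nat -> C) (K : fieldType)
    (iota : {rmorphism C -> K}) n (x : 'I_n.+1 -> K) (P : mpoly n.+1 C) :
  injective e -> P != 0 -> mmap iota x P = 0 ->
  exists (l : 'I_n.+1 -> C) (w : K), let x' i := x i - iota (l i) * w in
   [/\ l ord_max != 0, x' ord_max = 0 &
    forall (T : comNzRingType) (f : {rmorphism T -> K}),
    (forall c, integralOver f (iota c)) -> (forall i, integralOver f (x' i)) ->
    integralOver f w].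
Proof.
move=> e_inj P0 Px.
set D := (msize P).-1.
pose Ptop : mpoly n.+1 C :=
  \sum_(m <- msupp P | mdeg m == D) mcoeff m P *: mpolyX C m.
have Ptop0 : Ptop != 0.
  pose m0 := mlead P.
  have m0D : mdeg m0 == D by rewrite /D -(mlead_deg P0).
  have m0P : m0 \in msupp P by rewrite mlead_supp.
  suff : mcoeff m0 Ptop != 0 by apply: contraNneq => ->; rewrite mcoeff0.
  rewrite /Ptop big_mkcond (bigD1_seq m0) ?msupp_uniq //= m0D raddfD /=.
  rewrite mcoeffZ mcoeffX eqxx mulr1 raddf_sum big1 ?addr0 -?mcoeff_eq0 ?m0P //.
    by rewrite mcoeff_msupp in m0P.
  move=> m mm0; case: ifP => _; last by rewrite raddf0.
  by rewrite /= mcoeffZ mcoeffX (negbTE mm0) mulr0.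
(* The extra factor makes the last coordinate of [l] nonzero, so that [w] can be chosen to cancel
   [x' ord_max]. *)
have PX0 : Ptop * mpolyX C (mnm1 ord_max) != 0.
  rewrite mulf_neq0 //; apply/eqP => /(congr1 (mcoeff (mnm1 ord_max))).
  by rewrite mcoeffX eqxx mcoeff0 => /eqP; rewrite oner_eq0.
have [k kP] := mpoly_nonzero_value PX0 (fun=> e_inj).
set l := (X in meval X) in kP.
rewrite mevalM mevalXU mulf_eq0 negb_or in kP; have /andP[top0 lmax] := kP.
have il0 : iota (l ord_max) != 0 by rewrite fmorph_eq0.
exists l, (x ord_max / iota (l ord_max)) => x'; split=> //.
  by rewrite /x' mulrC divfK // subrr.
set w := x ord_max / _ => T f fiota fx'.
pose y i : {poly K} := (x' i)%:P + (iota (l i))%:P * 'X.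
pose p := mmap (@polyC K \o iota) y P.
have pw : p.[w] = 0.
  rewrite -Px /p; pose g : {rmorphism mpoly n.+1 C -> K} :=
    horner_eval w \o mmap (@polyC K \o iota) y.
  rewrite -[LHS]/(g P); move: {Px} (P); apply: mpoly_rmorph_eq => [c|i].
    by rewrite /g /= /horner_eval !mmapC /= hornerC.
  by rewrite /g /= /horner_eval !mmapX !mmap1U /y hornerD hornerMX !hornerC subrK.
have ym m : top_coef (mdeg m) (iota (\prod_i l i ^+ m i)) (mmap1 y m).
  rewrite /mmap1 rmorph_prod mdegE; apply: top_coef_prod => i.
  rewrite rmorphXn -[X in top_coef X]mul1n; apply: top_coefX; split.
    rewrite /y (leq_trans (size_polyD _ _)) // geq_max (leq_trans (size_polyC_leq1 _)) //=.
    by rewrite (leq_trans (size_polyMleq _ _)) // size_polyX addn2 /= ltnS size_polyC_leq1.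
  by rewrite coefD coefC coefMX coefC add0r.
have ptop : p`_D = iota (meval l Ptop).
  have -> : iota (meval l Ptop) = \sum_(m <- msupp P)
      (if mdeg m == D then iota (meval l (mcoeff m P *: mpolyX C m)) else 0).
    by rewrite /Ptop (raddf_sum (meval l)) (raddf_sum iota) -big_mkcond.
  rewrite /p /mmap coef_sum.
  apply: eq_big_seq => m mP /=; rewrite coefCM.
  have [s1 s2] := ym m; case: eqP => [<-|/eqP mD].
    by rewrite s2 mevalZ mevalX rmorphM.
  rewrite nth_default ?mulr0 //; apply: leq_trans s1 _.
  have := msize_mdeg_lt mP; rewrite -/D => mlt.
  rewrite ltn_neqAle mD /= /D; lia.
have sp : (size p <= D.+1)%N.
  rewrite /p /mmap big_seq.
  apply: (big_ind (fun q : {poly K} => (size q <= D.+1)%N)) => [|q1 q2 h1 h2|m mP].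
  - by rewrite size_poly0.
  - by rewrite (leq_trans (size_polyD _ _)) // geq_max h1.
  rewrite mul_polyC (leq_trans (size_scale_leq _ _)) // (leq_trans (ym m).1) //.
  have := msize_mdeg_lt mP; rewrite /D; lia.
have pint : coefs_integral f p.
  apply: coefs_integral_mmap => [c|i] /=; first exact: coefs_integralC.
  apply: coefs_integralD; first exact: coefs_integralC.
  by apply: coefs_integralM; [exact: coefs_integralC | exact: coefs_integralX].
have lp : lead_coef p = iota (meval l Ptop).
  rewrite -ptop lead_coefE; congr (_`_ _).
  apply/eqP; rewrite eqn_leq -ltnS prednK.
    rewrite sp /=; apply: contraNT top0; rewrite -ltnNge => h.
    rewrite -(fmorph_eq0 iota) -ptop nth_default //.
    by move: h; case: (size p).
  rewrite size_poly_gt0; apply: contraNneq top0 => p0.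
  by rewrite -(fmorph_eq0 iota) -ptop p0 coef0.
have lp0 : lead_coef p != 0 by rewrite lp fmorph_eq0.
apply: (@integral_root_monic _ _ f w ((lead_coef p)^-1 *: p)).
- by rewrite monicE lead_coefZ mulVf.
- by rewrite /root hornerZ pw mulr0.
apply/integral_poly => i; rewrite coefZ; apply: integral_mul => //.
by rewrite lp -fmorphV.
Qed.

(** The independent elements are recorded as polynomials [Q j] in the coordinates, so that they can
    be evaluated at every specialization of [x]. *)
Lemma noether_normalization (C : fieldType) (e : nat -> C) (K : fieldType)
    (iota : {rmorphism C -> K}) n (x : 'I_n -> K) : injective e ->
  exists d (Q : 'I_d -> mpoly n C),
    let t := mmap iota (fun j => mmap iota x (Q j)) in
    injective t /\ forall i, integralOver t (x i).
Proof.
move=> e_inj.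
have indep m (y : 'I_m -> K) : (forall P, mmap iota y P = 0 -> P = 0) ->
    exists d (Q : 'I_d -> mpoly m C),
    let t := mmap iota (fun j => mmap iota y (Q j)) in
    injective t /\ forall i, integralOver t (y i).
  move=> y_ind; exists m, (fun i => mpolyX C (mnm1 i)).
  rewrite (_ : (fun j => _) = y) => [t|]; last first.
    by apply/funext => j; rewrite mmapX mmap1U.
  have t_inj : injective t by apply: raddf_inj.
  split=> // i; have -> : y i = t (mpolyX C (mnm1 i)) by rewrite /t mmapX mmap1U.
  exact: integral_id.
elim: n x => [|n IHn] x.
  apply: indep => P; rewrite [P]mpoly0E mmapC => /eqP; rewrite fmorph_eq0 => /eqP ->.
  by rewrite mpolyC0.
have [ind|] := pselect (forall P, mmap iota x P = 0 -> P = 0); first exact: indep.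
move=> /existsNP[P /not_implyP[Px /eqP P0]].
have [l [w [lmax x'max w_int]]] := noether_step e_inj P0 Px.
set x' := (fun i => x i - iota (l i) * w) in x'max w_int.
pose widen := widen_ord (leqnSn n).
have [d [Q' [t_inj t_int]]] := IHn (x' \o widen).
pose L (i : 'I_n) : mpoly n.+1 C :=
  mpolyX C (mnm1 (widen i)) - mpolyC _ (l (widen i) / l ord_max) * mpolyX C (mnm1 ord_max).
have Lx i : mmap iota x (L i) = x' (widen i).
  have wE : w = x ord_max / iota (l ord_max).
    apply: (canRL (mulfK _)); first by rewrite fmorph_eq0.
    by apply/esym/eqP; rewrite mulrC -subr_eq0 x'max.
  rewrite /L mmapB mul_mpolyC mmapZ !mmapX !mmap1U /x' wE rmorphM fmorphV.
  by rewrite -!mulrA; congr (_ - _ * _); rewrite mulrC.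
pose Q j := mmap (@mpolyC n.+1 C) L (Q' j).
have Qx j : mmap iota x (Q j) = mmap iota (x' \o widen) (Q' j).
  rewrite /Q; pose g : {rmorphism mpoly n C -> K} :=
    mmap iota x \o mmap (@mpolyC n.+1 C) L.
  rewrite -[LHS]/(g _); move: (Q' j); apply: mpoly_rmorph_eq => [c|i].
    by rewrite /g /= !mmapC.
  by rewrite /g /= !mmapX !mmap1U Lx.
exists d, Q; rewrite (_ : (fun j => _) = fun j => mmap iota (x' \o widen) (Q' j)); last first.
  by apply/funext.
set t := mmap iota _ in t_inj t_int *; split=> // i.
have iota_int c : integralOver t (iota c).
  have -> : iota c = t (mpolyC _ c) by rewrite /t mmapC.
  exact: integral_id.
have x'_int : forall j, integralOver t (x' j).
  apply: ord_max_widenP => [j|]; first exact: t_int.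
  by rewrite (x'max : x' ord_max = 0); apply: mxpoly.integral0.
rewrite -[x i](subrK (iota (l i) * w)); apply: integral_add; first exact: x'_int.
by apply: integral_mul => //; apply: w_int.
Qed.

(** * Continuity of polynomials and of their roots *)

Section Closeness.
Context (C : numFieldType).

(** The order of [C] is partial; [a * b / (a + b)] is below both numbers without a comparison
    between them. *)
Lemma pos_min2 (a b : C) : 0 < a -> 0 < b -> exists c, [/\ 0 < c, c <= a & c <= b].
Proof.
move=> a0 b0; have ab : 0 < a + b by rewrite addr_gt0.
exists (a * b / (a + b)); split; first by rewrite divr_gt0 ?mulr_gt0.
  by rewrite ler_pdivrMr // ler_pM2l // lerDr ltW.
by rewrite ler_pdivrMr // mulrC ler_pM2l // lerDl ltW.
Qed.

Lemma pos_min_seq (I : eqType) (s : seq I) (v : I -> C) :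
  (forall i, i \in s -> 0 < v i) -> exists c, 0 < c /\ forall i, i \in s -> c <= v i.
Proof.
elim: s => [|i s IHs] vpos; first by exists 1; split; rewrite ?ltr01.
have [|c [c0 cle]] := IHs; first by move=> j js; apply: vpos; rewrite inE js orbT.
have [c' [c'0 c'c c'v]] := pos_min2 c0 (vpos i (mem_head _ _)).
exists c'; split=> // j; rewrite inE => /predU1P[->//|/cle].
exact: le_trans.
Qed.

Definition nearby n (t0 : 'I_n -> C) (Q : ('I_n -> C) -> Prop) : Prop :=
  exists d, 0 < d /\ forall t, (forall i, `|t i - t0 i| < d) -> Q t.

Lemma nearbyI n (t0 : 'I_n -> C) Q Q' :
  nearby t0 Q -> nearby t0 Q' -> nearby t0 (fun t => Q t /\ Q' t).
Proof.
move=> [d [d0 dQ]] [d' [d'0 d'Q]]; have [c [c0 cd cd']] := pos_min2 d0 d'0.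
exists c; split=> // t tc; split.
  by apply: dQ => i; apply: lt_le_trans (tc i) cd.
by apply: d'Q => i; apply: lt_le_trans (tc i) cd'.
Qed.

Lemma nearby_seq n (t0 : 'I_n -> C) (I : eqType) (s : seq I)
    (Q : I -> ('I_n -> C) -> Prop) :
  (forall i, i \in s -> nearby t0 (Q i)) ->
  nearby t0 (fun t => forall i, i \in s -> Q i t).
Proof.
elim: s => [|i s IHs] sQ; first by exists 1; split; rewrite ?ltr01.
have [|d [d0 dQ]] := nearbyI (sQ i (mem_head _ _)) (IHs _).
  by move=> j js; apply: sQ; rewrite inE js orbT.
exists d; split=> // t td j; have [Qi Qs] := dQ t td.
by rewrite inE => /predU1P[->//|/Qs].
Qed.

Lemma nearby_sub n (t0 : 'I_n -> C) (Q Q' : _ -> Prop) :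
  (forall t, Q t -> Q' t) -> nearby t0 Q -> nearby t0 Q'.
Proof. by move=> QQ' [d [d0 dQ]]; exists d; split=> // t /dQ/QQ'. Qed.

Definition cont_at n (t0 : 'I_n -> C) (f : ('I_n -> C) -> C) : Prop :=
  forall eps, 0 < eps -> nearby t0 (fun t => `|f t - f t0| < eps).

Lemma cont_atC n (t0 : 'I_n -> C) c : cont_at t0 (fun=> c).
Proof. by move=> eps e0; exists 1; split; rewrite ?ltr01 // => t _; rewrite subrr normr0. Qed.

Lemma cont_atD n (t0 : 'I_n -> C) f g :
  cont_at t0 f -> cont_at t0 g -> cont_at t0 (fun t => f t + g t).
Proof.
move=> cf cg eps e0; have e20 : 0 < eps / 2 by rewrite divr_gt0 ?ltr0n.
apply: nearby_sub (nearbyI (cf _ e20) (cg _ e20)) => t [ft gt].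
rewrite opprD addrACA (le_lt_trans (ler_normD _ _)) //.
by rewrite [eps]splitr ltrD.
Qed.

Lemma cont_atM n (t0 : 'I_n -> C) f g :
  cont_at t0 f -> cont_at t0 g -> cont_at t0 (fun t => f t * g t).
Proof.
move=> cf cg eps e0; have e20 : 0 < eps / 2 by rewrite divr_gt0 ?ltr0n.
have f0 : 0 < `|f t0| + 1 by rewrite ltr_wpDl ?ltr01.
have g0 : 0 < `|g t0| + 1 by rewrite ltr_wpDl ?ltr01.
have h1 := cf _ (divr_gt0 e20 g0).
have h2 := nearbyI (cg _ ltr01) (cg _ (divr_gt0 e20 f0)).
apply: nearby_sub (nearbyI h1 h2) => t [ft [g1t gt]].
have -> : f t * g t - f t0 * g t0 = (f t - f t0) * g t + f t0 * (g t - g t0).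
  by ring.
rewrite (le_lt_trans (ler_normD _ _)) // [eps]splitr !normrM.
have gle : `|g t| <= `|g t0| + 1.
  rewrite -[g t](subrK (g t0)) addrC (le_trans (ler_normD _ _)) // addrC.
  by rewrite addrC lerD2l ltW.
apply: ltr_leD.
  rewrite (le_lt_trans (ler_wpM2l _ gle)) ?normr_ge0 //.
  by rewrite -ltr_pdivlMr.
rewrite (le_trans (ler_wpM2r (normr_ge0 _) (_ : `|f t0| <= `|f t0| + 1))) ?lerDl ?ler01 //.
by rewrite mulrC -ler_pdivlMr // ltW.
Qed.

Lemma cont_at_ext n (t0 : 'I_n -> C) f g :
  f =1 g -> cont_at t0 f -> cont_at t0 g.
Proof. by move=> /funext ->. Qed.

Lemma cont_at_meval n (t0 : 'I_n -> C) (P : mpoly n C) :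
  cont_at t0 (fun t => meval t P).
Proof.
elim/mpolyind: P => [|c m p _ _ IHp].
  by move=> eps e0; exists 1; split; rewrite ?ltr01 // => t _; rewrite !meval0 subrr normr0.
have : cont_at t0 (fun t => c * meval t (mpolyX C m) + meval t p).
  apply: cont_atD IHp; apply: cont_atM; first exact: cont_atC.
  have : cont_at t0 (fun t => \prod_i t i ^+ m i).
    elim: (index_enum _) => [|i s IHs].
      by move=> eps e0; exists 1; split; rewrite ?ltr01 // => t _; rewrite !big_nil subrr normr0.
    have : cont_at t0 (fun t => t i ^+ m i * \prod_(i <- s) t i ^+ m i).
      apply: cont_atM IHs; elim: (m i) => [|k IHk].
        by move=> eps e0; exists 1; split; rewrite ?ltr01 // => t _; rewrite !expr0 subrr normr0.
      have : cont_at t0 (fun t => t i * t i ^+ k).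
        by apply: cont_atM IHk => eps e0; exists eps.
      by apply: cont_at_ext => t; rewrite exprS.
    by apply: cont_at_ext => t; rewrite big_cons.
  by apply: cont_at_ext => t; rewrite mevalX.
by apply: cont_at_ext => t; rewrite mevalD mevalZ.
Qed.

Lemma nearby_nonzero n (t0 : 'I_n -> C) (P : mpoly n C) (Q : ('I_n -> C) -> Prop) :
  P != 0 -> nearby t0 Q -> exists t, Q t /\ meval t P != 0.
Proof.
move=> P0 [d [d0 dQ]].
(* Infinitely many values within [d] of [t0 i]; denominators that start at 2 make the inequality
   strict. *)
pose z i k := t0 i + d / k.+2%:R.
have [|k kP] := mpoly_nonzero_value (z := z) P0.
  move=> i k l /addrI/(mulfI (lt0r_neq0 d0))/invr_inj/eqP.
  by rewrite eqr_nat => /eqP[].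
exists (fun i => z i (k i)); split=> //; apply: dQ => i.
rewrite /z addrAC subrr add0r; set m := (k i).+2.
rewrite normrM (gtr0_norm d0) normfV normr_nat ltr_pdivrMr ?ltr0n //.
by rewrite ltr_pMr // ltr1n.
Qed.

End Closeness.

Lemma prod_seq_ge (C : numDomainType) (I : eqType) (rs : seq I) (v : I -> C) a :
  0 <= a -> (forall r, r \in rs -> a <= v r) -> a ^+ size rs <= \prod_(r <- rs) v r.
Proof.
move=> a0; elim: rs => [|r rs IHrs] h; first by rewrite big_nil expr0.
rewrite big_cons exprS ler_pM ?exprn_ge0 //; first by apply: h; rewrite mem_head.
by apply: IHrs => j js; apply: h; rewrite inE js orbT.
Qed.

Section Roots.
Context (C : numClosedFieldType) (n : nat).
Implicit Types (t : 'I_n -> C) (F : {poly mpoly n C}).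

Lemma norm_geP (a : C) d : 0 < d -> ~ `|a| < d -> d <= `|a|.
Proof.
by move=> d0 /negP; rewrite -real_leNgt ?normr_real // ger0_real // ltW.
Qed.

Lemma size_meval_monic t F : F \is monic ->
  size (map_poly (meval t) F) = size F.
Proof. by move=> Fm; rewrite size_map_poly_id0 // (monicP Fm) rmorph1 oner_eq0. Qed.

(** Up to sign, the constant coefficient is the product of the [m] roots; once its norm is less than
    [d ^+ m], some root has norm less than [d]. *)
Lemma nearby_small_root t0 F d : 0 < d -> F \is monic ->
  (map_poly (meval t0) F).[0] = 0 ->
  nearby t0 (fun t => exists c, root (map_poly (meval t) F) c /\ `|c| < d).
Proof.
move=> d0 Fmon F0; set m := (size F).-1.
have Fv t : (map_poly (meval t) F).[0] = meval t F`_0.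
  by rewrite horner_coef0 coef_map.
rewrite Fv in F0.
have [|e [e0 he]] := @cont_at_meval C n t0 F`_0 (d ^+ m); first by rewrite exprn_gt0.
exists e; split=> // t /he; rewrite F0 subr0 => small.
apply: contrapT => /forallNP noroot.
have [rs Frs] := closed_field_poly_normal (map_poly (meval t) F).
have Ftmon : map_poly (meval t) F \is monic by rewrite monic_map.
rewrite (monicP Ftmon) scale1r in Frs.
have srs : size rs = m.
  by rewrite /m -(size_meval_monic t Fmon) Frs size_prod_XsubC.
move: small; rewrite -Fv Frs horner_prod normr_prod -srs => small.
suff /(prod_seq_ge (ltW d0)) ge : forall r, r \in rs -> d <= `|('X - r%:P).[0]|.
  by have := lt_le_trans small ge; rewrite ltxx.
move=> r rrs; rewrite hornerXsubC sub0r normrN.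
apply: norm_geP => // rd; apply: (noroot r); split=> //.
by rewrite Frs root_prod_XsubC.
Qed.

(** At a root [c] for [t] that is far from [rs], the polynomial for [t0] would be large, as a
    product of distances, and small, as the difference of two polynomials with close coefficients.
    Both estimates are relative to [(1 + |c|) ^+ m], hence uniform in [c]. *)
Lemma nearby_roots t0 F rs d : 0 < d -> F \is monic ->
  map_poly (meval t0) F = \prod_(r <- rs) ('X - r%:P) ->
  nearby t0 (fun t => forall c, root (map_poly (meval t) F) c ->
    exists2 r, r \in rs & `|c - r| < d).
Proof.
move=> d0 Fmon Frs; set m := size rs.
have sF : size F = m.+1 by rewrite -(size_meval_monic t0 Fmon) Frs size_prod_XsubC.
(* If [|c - r|] is at least [d], then [1 + (1 + |r|) / d] bounds the ratio of [1 + |c|] to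
   [|c - r|]; the sum serves all roots at once. *)
pose M := 1 + \sum_(r <- rs) (1 + `|r|) / d.
have r0 r : 0 <= (1 + `|r|) / d by rewrite divr_ge0 ?addr_ge0 ?ler01 ?normr_ge0 // ltW.
have sum0 : 0 <= \sum_(r <- rs) (1 + `|r|) / d by apply: sumr_ge0.
have M0 : 0 < M by apply: ltr_wpDr sum0 _; apply: ltr01.
(* There are [m.+1] coefficients; this choice leaves a factor 1/2 in the final comparison. *)
pose k := (2 * m.+1%:R * M ^+ m)^-1.
have k0 : 0 < k by rewrite invr_gt0 !mulr_gt0 ?ltr0n // exprn_gt0.
have [|e [e0 he]] := @nearby_seq C n t0 nat (iota 0 m.+1)
    (fun j t => `|meval t F`_j - meval t0 F`_j| < k).
  by move=> j _; apply: cont_at_meval.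
exists e; split=> // t /he{}he c /rootP Fc.
apply: contrapT => nor.
have far r : r \in rs -> 1 + `|c| <= M * `|c - r|.
  move=> rrs; have dcr : d <= `|c - r|.
    by apply: norm_geP => // h; apply: nor; exists r.
  have le1 : 1 + `|c| <= (1 + `|r|) + `|c - r|.
    by rewrite -addrA lerD2l -{1}[c](subrK r) addrC ler_normD.
  apply: le_trans le1 _.
  have le2 : (1 + `|r|) <= (1 + `|r|) / d * `|c - r|.
    rewrite -{1}[1 + `|r|](divfK (lt0r_neq0 d0)).
    by apply: ler_wpM2l.
  apply: le_trans (lerD le2 (lexx _)) _.
  rewrite -{2}[`|c - r|]mul1r -mulrDl addrC ler_wpM2r // lerD2l.
  by rewrite (big_rem r) //= lerDl sumr_ge0.
have c1 : 0 < 1 + `|c| by apply: ltr_wpDr (normr_ge0 c) _; apply: ltr01.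
have le1 : (1 + `|c|) ^+ m <= M ^+ m * `|(map_poly (meval t0) F).[c]|.
  have := prod_seq_ge (ltW c1) far; rewrite big_split /= big_const_seq count_predT.
  rewrite iter_mulr_1 -normr_prod => h; rewrite Frs horner_prod.
  apply: le_trans h _; rewrite le_eqVlt; apply/orP; left; apply/eqP.
  by congr (_ * `|_|); apply: eq_bigr => r _; rewrite hornerXsubC.
have le2 : `|(map_poly (meval t0) F).[c]| <= k * m.+1%:R * (1 + `|c|) ^+ m.
  have -> : (map_poly (meval t0) F).[c] =
      - \sum_(j < m.+1) (meval t F`_j - meval t0 F`_j) * c ^+ j.
    rewrite -[LHS]opprK; congr (- _); rewrite -[LHS]add0r -{1}Fc.
    rewrite !horner_coef !size_meval_monic // sF -sumrB; apply: eq_bigr => j _.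
    by rewrite !coef_map mulrBl.
  rewrite normrN; apply: le_trans (ler_norm_sum _ _ _) _.
  rewrite -mulrA mulrCA mulr_natl.
  have -> : (k * (1 + `|c|) ^+ m) *+ m.+1 = \sum_(j < m.+1) k * (1 + `|c|) ^+ m.
    by rewrite sumr_const card_ord.
  apply: ler_sum => j _; rewrite normrM ler_pM //.
    by apply: ltW; apply: (he); rewrite mem_iota add0n ltn_ord.
  rewrite normrX; apply: (@le_trans _ _ ((1 + `|c|) ^+ j)).
    by apply: lerXn2r; rewrite ?nnegrE ?normr_ge0 ?(ltW c1) // lerDr ler01.
  by rewrite ler_weXn2l ?lerDl // -ltnS.
have := le_trans le1 (ler_wpM2l (ltW (exprn_gt0 m M0)) le2).
have -> : M ^+ m * (k * m.+1%:R * (1 + `|c|) ^+ m) = (1 + `|c|) ^+ m / 2.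
  rewrite /k; have M'0 : M ^+ m != 0 by rewrite expf_neq0 // gt_eqF.
  by move: M'0; generalize (M ^+ m) => y y0; field; rewrite y0 nat1r pnatr_eq0.
have cm0 : 0 < (1 + `|c|) ^+ m by rewrite exprn_gt0.
by rewrite ler_pdivlMr ?ltr0n // mulr_natr mulr2n gerDl lt_geF.
Qed.

End Roots.

(** * Euclidean density of specializations *)

Definition specialization (C K : comNzRingType) (iota : {rmorphism C -> K}) n
    (x : 'I_n -> K) (y : 'I_n -> C) : Prop :=
  forall P : mpoly n C, mmap iota x P = 0 -> meval y P = 0.

Lemma mmap_map_mpoly (R S T : comNzRingType) (g : {rmorphism R -> S})
    (f : {rmorphism S -> T}) n (x : 'I_n -> T) (P : mpoly n R) :
  mmap f x (map_mpoly g P) = mmap (f \o g) x P.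
Proof.
pose h : {rmorphism mpoly n R -> T} := mmap f x \o map_mpoly g.
rewrite -[LHS]/(h P); move: P; apply: mpoly_rmorph_eq => [c|i].
  by rewrite /h /= map_mpolyC !mmapC.
by rewrite /h /= map_mpolyX !mmapX !mmap1U.
Qed.

Lemma mmap_comp_mpoly (C S : comNzRingType) (f : {rmorphism C -> S}) n d
    (Q : 'I_d -> mpoly n C) (x : 'I_n -> S) (P : mpoly d C) :
  mmap f x (mmap (@mpolyC n C) Q P) = mmap f (fun j => mmap f x (Q j)) P.
Proof.
pose h : {rmorphism mpoly d C -> S} := mmap f x \o mmap (@mpolyC n C) Q.
rewrite -[LHS]/(h P); move: P; apply: mpoly_rmorph_eq => [c|i].
  by rewrite /h /= !mmapC.
by rewrite /h /= !mmapX !mmap1U.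
Qed.

Section Specialize.
Context (C : comNzRingType) (K : comNzRingType) (iota : {rmorphism C -> K}).
Context (n d : nat) (x : 'I_n -> K) (Q : 'I_d -> mpoly n C).

(** Putting the [Q j] for the variables and [v] for the indeterminate turns the equation into a
    polynomial relation [E] between the coordinates of [x]. *)
Lemma specialization_poly (y : 'I_n -> C) (p : {poly mpoly d C}) (v : mpoly n C) :
  specialization iota x y ->
  (map_poly (mmap iota (fun j => mmap iota x (Q j))) p).[mmap iota x v] = 0 ->
  (map_poly (meval (fun j => meval y (Q j))) p).[meval y v] = 0.
Proof.
move=> xy.
pose E := (map_poly (mmap (@mpolyC n C) Q) p).[v].
have EE (S : comNzRingType) (f : {rmorphism C -> S}) (z : 'I_n -> S) :
    mmap f z E = (map_poly (mmap f (fun j => mmap f z (Q j))) p).[mmap f z v].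
  rewrite /E -horner_map -map_poly_comp; congr (_.[_]).
  by apply: eq_map_poly => r /=; rewrite mmap_comp_mpoly.
by rewrite -EE => /xy; rewrite /meval EE.
Qed.

End Specialize.

Section Density.
Context (C : numClosedFieldType) (K : fieldType) (iota : {rmorphism C -> K}).

(** For each of the finitely many candidates other than [y], the required inequality excludes the
    zeros of a nonzero linear form in [l]; a point where the product of these forms is nonzero suits
    all of them. *)
Lemma exists_separating_form n (y : 'I_n -> C) (rs : 'I_n -> seq C) :
  exists (l : 'I_n -> C) eta, 0 < eta /\
    forall z : 'I_n -> C, (forall i, z i \in rs i) -> z <> y ->
      eta <= `|\sum_i l i * (z i - y i)|.
Proof.
(* [m] bounds all indices, so the finite functions [g] reach every point of the product of the
   [rs i]; the default [y i] only adds harmless candidates. *)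
pose m := \sum_i size (rs i).
pose z (g : {ffun 'I_n -> 'I_m}) i := nth (y i) (rs i) (g i).
pose W g := \sum_i (z g i - y i) *: mpolyX C (mnm1 i).
have Wv g l : meval l (W g) = \sum_i l i * (z g i - y i).
  rewrite /W raddf_sum; apply: eq_bigr => i _ /=.
  by rewrite mevalZ mevalXU mulrC.
have W0 g : z g <> y -> W g != 0.
  move=> zy; have [i zyi] : exists i, z g i != y i.
    apply: contrapT => /forallNP h; apply: zy; apply/funext => i.
    by apply/eqP/negPn/negP/h.
  apply/eqP => /(congr1 (mcoeff (mnm1 i))); rewrite mcoeff0 raddf_sum (bigD1 i) //=.
  rewrite mcoeffZ mcoeffX eqxx mulr1 big1 ?addr0 => [|j ji].
    by apply/eqP; rewrite subr_eq0.
  by rewrite mcoeffZ mcoeffX eq_mnm1 (negbTE ji) mulr0.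
pose good g := `[< z g <> y >].
have P0 : \prod_(g | good g) W g != 0.
  by apply/prodf_neq0 => g /asboolP; apply: W0.
have [k kP] := mpoly_nonzero_value P0 (fun=> mulrIn (oner_neq0 C)).
set l := (X in meval X) in kP.
have lW g : good g -> \sum_i l i * (z g i - y i) != 0.
  by move=> gg; move: kP; rewrite -/l rmorph_prod prodf_seq_neq0 => /allP/(_ g);
    rewrite mem_index_enum gg /= Wv; apply.
have [|eta [eta0 etale]] := @pos_min_seq C _ [seq g <- enum {ffun 'I_n -> 'I_m} | good g]
    (fun g => `|\sum_i l i * (z g i - y i)|).
  by move=> g; rewrite mem_filter normr_gt0 => /andP[/lW].
exists l, eta; split=> // v vrs vy.
have im i : (index (v i) (rs i) < m)%N.
  apply: (@leq_trans (size (rs i))); first by rewrite index_mem.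
  by rewrite /m (bigD1 i) //= leq_addr.
pose g := [ffun i => Ordinal (im i)].
have zg : z g = v by apply/funext => i; rewrite /z ffunE nth_index.
rewrite -zg; apply: etale; rewrite mem_filter mem_enum andbT.
by apply/asboolP; rewrite zg.
Qed.

(* Over the Noether normalization [t] of [x], the form [u] vanishes at [y] but at
   no other point of the fiber of [y]. As the base is integrally closed, the
   minimal polynomial of [u] specializes at [y], so a generic [t'] near [t(y)] has
   a root [c] near [0]; a lift [y'] of [(t', c)] is close to some point of the
   fiber of [y], where [u] is small: this point is [y]. *)
Lemma specialization_dense n (x : 'I_n -> K) (y : 'I_n -> C) (H : mpoly n C) (eps : C) :
  specialization iota x y -> mmap iota x H != 0 -> 0 < eps ->
  exists y', [/\ specialization iota x y', forall i, `|y' i - y i| < eps &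
    meval y' H != 0].
Proof.
move=> xy Hx eps0.
have e_inj : injective (fun k => k%:R : C) by apply: mulrIn; apply: oner_neq0.
have [d [Q [t_inj x_int]]] := noether_normalization iota x e_inj.
set tau := mmap iota _ in t_inj x_int.
pose t0 j := meval y (Q j).
have /choice[F FP] : forall i, exists p : {poly mpoly d C},
    p \is monic /\ root (map_poly tau p) (x i).
  by move=> i; have [p pm px] := x_int i; exists p.
have Fspec y' i : specialization iota x y' ->
    root (map_poly (meval (fun j => meval y' (Q j))) (F i)) (y' i).
  move=> xy'; have [_ /rootP Fx] := FP i; apply/rootP.
  have := @specialization_poly C K iota n d x Q y' (F i) (mpolyX C (mnm1 i)) xy'.
  by rewrite mmapX mmap1U mevalXU; apply.
have /choice[rs rsP] : forall i, exists s : seq C,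
    map_poly (meval t0) (F i) = \prod_(r <- s) ('X - r%:P).
  move=> i; have [s sE] := closed_field_poly_normal (map_poly (meval t0) (F i)).
  exists s; rewrite [LHS]sE; have /monicP -> : map_poly (meval t0) (F i) \is monic.
    by rewrite monic_map //; have [] := FP i.
  by rewrite scale1r.
have [l [eta [eta0 etaP]]] := exists_separating_form y rs.
pose U : mpoly n C := \sum_i l i *: (mpolyX C (mnm1 i) - mpolyC n (y i)).
have Uv v : meval v U = \sum_i l i * (v i - y i).
  rewrite /U raddf_sum; apply: eq_bigr => i _ /=.
  by rewrite mevalZ mevalB mevalXU mevalC.
pose u := mmap iota x U.
have iota_int c : integralOver tau (iota c).
  have -> : iota c = tau (mpolyC _ c) by rewrite /tau mmapC.
  exact: integral_id.
have u_int : integralOver tau u.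
  rewrite /u /U raddf_sum; apply: integralOver_sum => i /=.
  rewrite mmapZ mmapB mmapX mmap1U mmapC; apply: integral_mul => //.
  by apply: integral_sub; [exact: x_int | exact: iota_int].
have [G [Gmon Gu Gmin]] := monic_minpoly (@int_closed_mpoly C _ d e_inj) t_inj u_int.
have Uy : meval y U = 0.
  by rewrite Uv big1 // => i _; rewrite subrr mulr0.
have G0 : (map_poly (meval t0) G).[0] = 0.
  by have := @specialization_poly C K iota n d x Q y G U xy (rootP Gu); rewrite Uy.
(* The coordinates [x] are extended over the base [mpoly d C] with [u] adjoined, so that a value [c]
   of [u] can be prescribed together with the base point [t]. *)
pose alpha : {rmorphism {poly mpoly d C} -> K} := horner_eval u \o map_poly tau.
pose cst : {rmorphism C -> {poly mpoly d C}} := polyC \o @mpolyC d C.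
pose lift : {rmorphism mpoly n C -> mpoly n {poly mpoly d C}} := map_mpoly cst.
have lift_iota P : mmap alpha x (lift P) = mmap iota x P.
  rewrite /lift /= mmap_map_mpoly; apply: eq_bigr => m _; congr (_ * _).
  by rewrite /= map_polyC /horner_eval hornerC /= /tau mmapC.
have Hx' : mmap alpha x (lift H) != 0 by rewrite lift_iota.
have [s [alpha_s ext]] := generic_extension C Hx'.
have Gtau0 : map_poly tau G != 0.
  by rewrite (raddf_eq0 _ (map_inj_poly t_inj (rmorph0 _))) monic_neq0.
(* [r] depends on the base point alone. Modulo [G] it is a multiple of [s], so where it is nonzero,
   [s] is nonzero at [(t, c)] for every root [c] of [G] over [t]. *)
have [V [r [tau_r rV]]] := inv_mod_annihilator Gtau0 Gu alpha_s.
have r0 : r != 0 by apply: contraNneq tau_r => ->; rewrite rmorph0.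
have [GV GVE] : exists GV, r%:P - V * s = GV * G.
  apply: Gmin; apply/rootP; rewrite rmorphB rmorphM /= map_polyC hornerD hornerN.
  by rewrite hornerM hornerC /= rV subrr.
(* Moving each coordinate by less than [del] changes the form by at most [Lam * del], so by at most
   [eta / 2]; the other half is for [c]. *)
pose Lam := \sum_i `|l i| + 1.
have Lam0 : 0 < Lam by rewrite ltr_wpDl ?ltr01 // sumr_ge0.
have eta20 : 0 < eta / 2 by rewrite divr_gt0 ?ltr0n.
have [del [del0 del_eps del_eta]] := pos_min2 eps0 (divr_gt0 eta20 Lam0).
have near1 : nearby t0 (fun t => forall i, i \in enum 'I_n -> forall c,
    root (map_poly (meval t) (F i)) c -> exists2 r, r \in rs i & `|c - r| < del).
  by apply: nearby_seq => i _; apply: nearby_roots => //; have [] := FP i.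
have near2 := nearby_small_root eta20 Gmon G0.
have [t [[tF [c [/rootP Gc c_small]]] rt]] := nearby_nonzero r0 (nearbyI near1 near2).
pose g : {rmorphism {poly mpoly d C} -> C} := horner_eval c \o map_poly (meval t).
have gG : g G = 0 by rewrite /g /= /horner_eval Gc.
have alphaG : alpha G = 0 by apply/rootP.
(* Here integral closedness of the base counts: all relations of [u] are multiples of [G], so any
   root of [G] over [t] satisfies them. *)
have compat p : alpha p = 0 -> g p = 0.
  by move=> /rootP/Gmin[H1 ->]; rewrite rmorphM gG mulr0.
have gs : g s != 0.
  apply: contraNneq rt => gs0; have := compat (r%:P - V * s).
  rewrite {1}GVE rmorphM alphaG mulr0 => /(_ erefl).
  by rewrite rmorphB rmorphM gs0 mulr0 subr0 /= map_polyC /horner_eval hornerC /= => ->.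
have [y' [y'spec y'H]] := ext g compat gs.
have lift_g P : mmap g y' (lift P) = meval y' P.
  rewrite /lift /= mmap_map_mpoly; apply: eq_bigr => m _; congr (_ * _).
  by rewrite /= map_polyC /horner_eval hornerC /= mevalC.
have xy' : specialization iota x y'.
  by move=> P Px; rewrite -lift_g; apply: y'spec; rewrite lift_iota.
have transfer (a : {poly mpoly d C}) P : alpha a = mmap iota x P -> g a = meval y' P.
  move=> aP; apply/eqP; rewrite -subr_eq0 -lift_g -[g a](mmapC y' g) -mmapB.
  apply/eqP/y'spec; rewrite mmapB mmapC lift_iota; apply/eqP.
  by rewrite subr_eq0; apply/eqP; exact: aP.
have y'Q : (fun j => meval y' (Q j)) = t.
  apply/funext => j; rewrite -(transfer (mpolyX C (mnm1 j))%:P).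
    by rewrite /g /= map_polyC /horner_eval hornerC /= mevalXU.
  by rewrite /alpha /= map_polyC /horner_eval hornerC /= /tau mmapX mmap1U.
have y'U : meval y' U = c.
  rewrite -(transfer 'X); first by rewrite /g /= map_polyX /horner_eval hornerX.
  by rewrite /alpha /= map_polyX /horner_eval hornerX.
have /choice[z zP] : forall i, exists r, r \in rs i /\ `|y' i - r| < del.
  move=> i; have := Fspec y' i xy'; rewrite y'Q => /(tF i (mem_enum _ _)).
  by case=> r' r'rs r'd; exists r'.
have zy : z = y.
  apply: contrapT => zy.
  have etale := etaP z (fun i => (zP i).1) zy.
  suff : eta < eta by rewrite ltxx.
  apply: le_lt_trans etale _.
  have -> : \sum_i l i * (z i - y i) = c + \sum_i l i * (z i - y' i).
    rewrite -y'U Uv -big_split; apply: eq_bigr => i _ /=.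
    by ring.
  rewrite (le_lt_trans (ler_normD _ _)) // [eta]splitr ltr_leD //.
  rewrite (le_trans (ler_norm_sum _ _ _)) //.
  apply: (@le_trans _ _ (\sum_i `|l i| * del)).
    apply: ler_sum => i _; rewrite normrM ler_wpM2l // distrC.
    exact/ltW/(zP i).2.
  rewrite -mulr_suml (@le_trans _ _ (Lam * del)) //.
    by rewrite ler_wpM2r ?lerDl ?ler01 // ltW.
  by rewrite mulrC -ler_pdivlMr.
exists y'; split=> //; last by rewrite -lift_g.
by move=> i; rewrite -zy; apply: lt_le_trans (zP i).2 _.
Qed.

End Density.

(** * Closed points and continuous rational functions *)

Section EuclideanSubset.
Context (C : numFieldType) (n : nat) (X : set 'rV[C]_n).

Lemma continuous_setP (f : X -> C) : continuous f <->
  forall (p : X) (eps : C), 0 < eps -> exists2 d : C, 0 < d & forall q : X,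
    (forall i, `|set_val q ord0 i - set_val p ord0 i| < d) -> `|f q - f p| < eps.
Proof.
split=> [fc p eps e0|h p].
  have : nbhs p (f @^-1` ball (f p) eps) by apply: fc; apply: nbhsx_ballx.
  move=> [_ [[W oW <-] /= Wp WU]].
  have /nbhs_ballP[d /= d0 hd] : nbhs (set_val p) W by apply: open_nbhs_nbhs.
  exists d => // q qd; rewrite distrC; apply: (WU q); apply: hd; split=> // i j.
  by rewrite /ball /= (ord1 i) distrC; apply: qd.
apply/(@cvgrPdist_lt _ _ _ _ (nbhs_filter p)) => eps e0; have [d d0 hd] := h p eps e0.
have nb : nbhs p (set_val @^-1` ball (set_val p) d).
  by apply: initial_continuous; apply: nbhsx_ballx.
apply: (@filterS _ _ (nbhs_filter p) _ _ _ nb) => q [_ qd]; rewrite distrC; apply: hd => i.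
by have := qd ord0 i; rewrite /ball /= distrC.
Qed.

End EuclideanSubset.

(** The set [M] of the products [h ^+ k * g] with [g] nonzero at [y] avoids [J]. The resulting tuple
    [x] is a zero of [J] where [h] is nonzero, and it specializes to [y] because no such [g] is
    killed. *)
Lemma zero_set_dense (C : numClosedFieldType) n (J : set (mpoly n C))
    (y : 'I_n -> C) h (eps : C) :
  is_ideal J -> (forall g k, J (h ^+ k * g) -> meval y g = 0) -> 0 < eps ->
  exists y', [/\ forall P, J P -> meval y' P = 0, forall i, `|y' i - y i| < eps &
    meval y' h != 0].
Proof.
move=> Jid Jh e0.
pose M : set (mpoly n C) := [set a | exists k g, meval y g != 0 /\ a = h ^+ k * g].
have [||K [psi [psiJ psiM]]] := @exists_residue_field _ J M Jid.
- split; first by exists 0%N, 1; rewrite meval1 oner_eq0 mulr1.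
  move=> a b [k [g [g0 ->]]] [l [g' [g'0 ->]]]; exists (k + l)%N, (g * g').
  by rewrite mevalM mulf_neq0 // exprD mulrACA.
- rewrite -subset0 => a [Ja [k [g [g0 aE]]]].
  by move: Ja g0; rewrite aE => /Jh ->; rewrite eqxx.
pose iota : {rmorphism C -> K} := psi \o @mpolyC n C.
pose x i := psi (mpolyX C (mnm1 i)).
have psiE P : mmap iota x P = psi P by rewrite -mmapE_rmorph.
have hM : M h by exists 1%N, 1; rewrite meval1 oner_eq0 mulr1.
have [|||y' [xy' y'y y'h]] := @specialization_dense C K iota n x y h eps.
- move=> P; rewrite psiE => P0; apply: contraPP P0 => /eqP Py.
  by apply/eqP/psiM; exists 0%N, P; rewrite mul1r.
- by rewrite psiE; apply: psiM.
- exact: e0.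
exists y'; split=> // P /psiJ P0; apply: xy'; by rewrite psiE.
Qed.

(* If [t] kills [a] and [t b != 0] then [a + t b] has a smaller annihilator than
   [a]: this cannot go on forever in a reduced noetherian ring. *)
Lemma exists_nonzerodivisor (C : fieldType) n (A : comPzRingType)
    (phi : {rmorphism mpoly n C -> A}) (I : set (mpoly n C)) :
  (forall a, exists P, phi P = a) -> reduced_ring A -> is_ideal I ->
  (forall t, (forall q, I q -> phi (t * q) = 0) -> phi t = 0) ->
  exists2 s, I s & nonzerodivisor (phi s).
Proof.
move=> phi_surj A_red [I0 ID IM] AnnI.
have sq0 (a : A) : a * a = 0 -> a = 0 by move=> aa; apply: (A_red a 2%N); rewrite expr2.
apply: contrapT => noS.
have step a : exists a', I a -> [/\ I a', forall x, phi (x * a') = 0 -> phi (x * a) = 0 &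
    exists c, phi (c * a) = 0 /\ phi (c * a') != 0].
  have [Ia|] := pselect (I a); last by exists 0.
  have [t' [at0 t0]] : exists t', phi a * t' = 0 /\ t' <> 0.
    apply: contrapT => /forallNP h; apply: noS; exists a => //.
    apply/nonzerodivisorP => t at0; apply: contrapT => t0.
    by apply: (h t).
  have [t tE] := phi_surj t'; rewrite -tE in at0 t0.
  have [b [Ib tb]] : exists b, I b /\ phi (t * b) <> 0.
    apply: contrapT => /forallNP h; apply: t0; apply: AnnI => q Iq.
    by apply: contrapT => tq; apply: (h q).
  have ca : phi (t * b * a) = 0.
    by rewrite mulrAC [t * a]mulrC !rmorphM at0 mul0r.
  exists (a + t * b) => _; split.
  - by apply: ID => //; apply: IM.
  - move=> x; rewrite mulrDr rmorphD => /eqP; rewrite addr_eq0 => /eqP xa.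
    (* As [x a] equals [- x t b], its square is a multiple of [t b a], which is 0 in [A]. *)
    apply: sq0; rewrite {1}xa -rmorphN -rmorphM.
    have -> : - (x * (t * b)) * (x * a) = - (x * x) * (t * b * a) by ring.
    by rewrite rmorphM ca mulr0.
  - exists (t * b); split=> //; rewrite mulrDr rmorphD ca add0r rmorphM.
    by apply/eqP => /sq0.
have [next nextP] := choice step.
pose a k := iter k next 0.
have aI k : I (a k) by elim: k => [|k IHk] //=; have [] := nextP _ IHk.
have ann k i x : (i <= k)%N -> phi (x * a k) = 0 -> phi (x * a i) = 0.
  elim: k => [|k IHk]; first by rewrite leqn0 => /eqP->.
  rewrite leq_eqVlt => /predU1P[->//|ik] xa; apply: IHk => //.
  by have [_ h _] := nextP _ (aI k); apply: h; exact: xa.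
have [k [r e]] := noetherian_mpoly (fun k => a k.+1).
(* [c] kills [a k], hence all earlier terms by [ann], hence their combination [a k.+1]. *)
have [_ _ [c [ca /eqP]]] := nextP _ (aI k); apply.
rewrite -[next (a k)]/(a k.+1) [a k.+1]e mulr_sumr rmorph_sum big1 // => i _.
by rewrite mulrCA rmorphM (ann k) ?mulr0.
Qed.

(** * Ideals of denominators *)

Section Peval.
Context (R : realType) (n : nat) (X : set 'rV[Cx R]_n).

Lemma continuous_peval (P : mpoly n (Cx R)) : continuous (@peval R n X P).
Proof.
apply/continuous_setP => p eps e0.
have [d [d0 hd]] := @cont_at_meval (Cx R) n (set_val p ord0) P eps e0.
by exists d => // q /hd.
Qed.

Lemma zariski_open_setT : zariski_open [set: X].
Proof.
exists [set 1]; apply/seteqP; split=> p; first by case.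
by move=> /(_ 1 erefl); rewrite /peval meval1 => /eqP; rewrite oner_eq0.
Qed.

Definition denominators (f : X -> Cx R) : set (mpoly n (Cx R)) :=
  [set q | exists a, forall x, peval q x * f x = peval a x].

Lemma denominators_ideal f : is_ideal (denominators f).
Proof.
split.
- by exists 0 => x; rewrite /peval !meval0 mul0r.
- move=> q q' [a ha] [a' ha']; exists (a + a') => x.
  by rewrite /peval !mevalD mulrDl; congr (_ + _); [apply: ha|apply: ha'].
- move=> r q [a ha]; exists (r * a) => x.
  by rewrite /peval !mevalM -mulrA; congr (_ * _); apply: ha.
Qed.

(** A polynomial [T] that vanishes off [V] but not at [p] extends the local equality [Q f = P] to
    [Q T f = P T] on all of [X]. *)
Lemma denominators_regular U f p : regular_on U f -> U p ->
  exists2 q, denominators f q & peval q p != 0.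
Proof.
move=> fU Up; have [V [P [Q [[S VS] Vp VU fV]]]] := fU p Up.
have VE x : V x <-> exists T, S T /\ peval T x != 0.
  have -> : V x <-> ~ (~` V) x by split=> [Vx|/contrapT].
  rewrite VS; split=> [/existsNP[T /not_implyP[ST Tx]]|[T [ST Tx]] h].
    by exists T; split=> //; apply/eqP.
  by rewrite (h T ST) eqxx in Tx.
have [T [ST Tp]] := (VE p).1 Vp.
exists (Q * T).
  exists (P * T) => x; rewrite /peval !mevalM.
  have [Tx|Tx] := eqVneq (peval T x) 0.
    by move: Tx; rewrite /peval => ->; rewrite !mulr0 mul0r.
  have [Qx ->] : peval Q x != 0 /\ f x = peval P x / peval Q x.
    by apply: fV; apply/VE; exists T.
  by rewrite mulrC mulrA [peval P x / _ * _]divfK.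
by rewrite /peval mevalM mulf_neq0 //; have [] := fV p Vp.
Qed.

End Peval.

(** * Regular functions and dense principal open subsets *)

Section Coordinate.
Context (R : realType) (n : nat) (A : comPzRingType).
Context (phi : {rmorphism mpoly n (Cx R) -> A}).
Hypothesis phi_surj : forall a : A, exists P, phi P = a.
Local Notation X := (closed_points phi).

Lemma kernel_ideal : is_ideal [set P | phi P = 0].
Proof.
split=> [|a b|r a] /=; first by rewrite rmorph0.
  by move=> a0 b0; rewrite rmorphD a0 b0 addr0.
by move=> a0; rewrite rmorphM a0 mulr0.
Qed.

Lemma closed_pointE (v : 'I_n -> Cx R) : (forall P, phi P = 0 -> meval v P = 0) ->
  exists p : X, set_val p ord0 = v.
Proof.
move=> hv; pose x : 'rV[Cx R]_n := \row_i v i.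
have xv : x ord0 = v by apply/funext => i; rewrite mxE.
have xX : X x by move=> P /hv; rewrite xv.
by exists (SigSub (mem_set xX)).
Qed.

Lemma peval_kernel P (p : X) : phi P = 0 -> peval P p = 0.
Proof. exact: (set_valP p). Qed.

Lemma coord_fun_range f : range (coord_fun phi) f <-> exists P, f = peval P.
Proof.
split=> [[a _ <-]|[P ->]]; last by exists (phi P); rewrite ?coord_funE.
by have [P <-] := phi_surj a; exists P; rewrite coord_funE.
Qed.

(** For a regular [f] the denominators have no common zero on [X]. They include the kernel of [phi],
    with numerator 0, so they have no common zero at all, and 1 is a denominator. *)
Lemma regular_functionsE : regular_functions X = range (coord_fun phi).
Proof.
apply/seteqP; split=> f; last first.
  move=> /coord_fun_range[P ->] p _; exists setT, P, 1; split=> //.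
    exact: zariski_open_setT.
  by move=> q _; rewrite /peval meval1 oner_eq0 divr1.
move=> freg; apply/coord_fun_range.
have [[P fP]|none] := pselect (denominators f 1).
  by exists P; apply/funext => x; rewrite -fP /peval meval1 mul1r.
have [v vI] := weak_nullstellensatz (denominators_ideal f) none.
have [|p pv] := closed_pointE (v := v).
  move=> P P0; apply: vI; exists 0 => x.
  by rewrite peval_kernel // /peval meval0 mul0r.
have [q qf] := denominators_regular freg (I : [set: X] p).
by rewrite /peval pv vI // eqxx.
Qed.

Section Reduced.
Hypothesis A_reduced : reduced_ring A.

Lemma peval_eq0 P : (forall p : X, peval P p = 0) -> phi P = 0.
Proof.
move=> P0; apply: contrapT => phiP.
have [|v [vK vP]] := @nullstellensatz (Cx R) n [set P | phi P = 0] P kernel_ideal.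
  by move=> k; rewrite /= rmorphXn => /A_reduced.
have [p pv] := closed_pointE vK.
by move: (P0 p); rewrite /peval pv => vP0; rewrite vP0 eqxx in vP.
Qed.

Lemma coord_fun_inj : injective (coord_fun phi).
Proof.
move=> a b; have [P <-] := phi_surj a; have [Q <-] := phi_surj b.
rewrite !coord_funE => PQ; apply/eqP; rewrite -subr_eq0 -rmorphB.
apply/eqP/peval_eq0 => p; rewrite /peval mevalB.
by move: (congr1 (fun g => g p) PQ); rewrite /peval => ->; rewrite subrr.
Qed.

(** At each point of [U] some denominator is nonzero, so an element killed by all denominators
    vanishes on [U], hence on [X] by density, hence is 0 as [A] is reduced. *)
Lemma rational_denominator (f : X -> Cx R) : rational_fun f ->
  exists2 s, denominators f s & nonzerodivisor (phi s).
Proof.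
move=> [U [_ Udense fU]].
apply: exists_nonzerodivisor phi_surj A_reduced (denominators_ideal f) _.
move=> t tI; apply: peval_eq0 => p.
pose Z : set X := [set p | peval t p = 0].
suff ZT : Z = setT by have : Z p by rewrite ZT.
apply: Udense.
  by exists [set t]; apply/seteqP; split=> x; [move=> xt P -> | apply].
move=> x Ux; have [q qf qx] := denominators_regular fU Ux.
have := peval_kernel x (tI q qf); rewrite /peval mevalM => /eqP.
by rewrite mulf_eq0 => /orP[/eqP//|h]; move: qx; rewrite /peval h.
Qed.

Lemma nonzerodivisor_dense (s : mpoly n (Cx R)) (p : X) (eps : Cx R) :
  nonzerodivisor (phi s) -> 0 < eps ->
  exists q : X, (forall i, `|set_val q ord0 i - set_val p ord0 i| < eps) /\
    peval s q != 0.
Proof.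
move=> /nonzerodivisorP s_nzd e0.
have [|y [yK yp ys]] := zero_set_dense (y := set_val p ord0) (h := s) kernel_ideal _ e0.
  move=> g k /=; rewrite rmorphM rmorphXn => sg; apply: peval_kernel.
  by elim: k sg => [|k IHk]; rewrite ?expr0 ?mul1r // exprS -mulrA => /s_nzd.
have [q qy] := closed_pointE yK.
by exists q; split; [move=> i; rewrite qy | rewrite /peval qy].
Qed.

Lemma continuous_eq_dense (f : X -> Cx R) (s B : mpoly n (Cx R)) :
  nonzerodivisor (phi s) -> continuous f ->
  (forall p, peval s p != 0 -> f p = peval B p) -> f = peval B.
Proof.
move=> s_nzd /continuous_setP fc fB; apply/funext => p.
have /continuous_setP Bc := @continuous_peval R n X B.
apply: contrapT => /eqP; rewrite -subr_eq0 -normr_gt0 => gap.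
have gap2 : 0 < `|f p - peval B p| / 2 by rewrite divr_gt0 ?ltr0n.
have [d1 d10 h1] := fc p _ gap2; have [d2 d20 h2] := Bc p _ gap2.
have [d [d0 dd1 dd2]] := pos_min2 d10 d20.
have [q [qp sq]] := nonzerodivisor_dense p s_nzd d0.
suff : `|f p - peval B p| < `|f p - peval B p| by rewrite ltxx.
apply: le_lt_trans (ler_distD (f q) (f p) (peval B p)) _.
rewrite [X in _ < X]splitr {2}(fB q sq) ltrD //.
  by rewrite distrC; apply: h1 => i; apply: lt_le_trans (qp i) dd1.
by apply: h2 => i; apply: lt_le_trans (qp i) dd2.
Qed.

End Reduced.
End Coordinate.

Section MwidenEval.
Context (S : comNzRingType) (n : nat) (y : 'I_n.+1 -> S).
Local Notation yw := (y \o widen_ord (leqnSn n)).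

Lemma meval_mwiden (p : mpoly n S) : meval y (mwiden p) = meval yw p.
Proof. by rewrite /meval mmap_muni muni_mwiden map_polyC hornerC. Qed.

Lemma meval_mwidenMX (p : mpoly n S) :
  meval y (mwiden p * mpolyX S (mnm1 ord_max)) = meval yw p * y ord_max.
Proof. by rewrite mevalM mevalXU meval_mwiden. Qed.

Lemma meval_mwidenBMX (p q : mpoly n S) :
  meval y (mwiden p - mwiden q * mpolyX S (mnm1 ord_max)) =
  meval yw p - meval yw q * y ord_max.
Proof. by rewrite mevalB meval_mwidenMX meval_mwiden. Qed.

End MwidenEval.

(** * Leading coefficients of the relations of a continuous rational function *)

Section Integrality.
Context (R : realType) (n : nat) (A : comPzRingType).
Context (phi : {rmorphism mpoly n (Cx R) -> A}).
Local Notation X := (closed_points phi).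
Local Notation P := (mpoly n (Cx R)).
Context (f : X -> Cx R) (s a : P).
Hypothesis sf : forall x : X, peval s x * f x = peval a x.

(* The polynomials over [P] that vanish at the fraction [a / s]. *)
Definition vanishing_at_fun : set {poly P} :=
  [set p | forall x : X, peval s x != 0 ->
    (map_poly (meval (set_val x ord0)) p).[f x] = 0].

(** The coefficient is taken in a degree [N] that only bounds the degree of [p], so that 0 and sums
    with cancellation are included. *)
Definition leading_coefs : set P :=
  [set l | exists N (p : {poly P}),
    [/\ vanishing_at_fun p, (size p <= N.+1)%N & p`_N = l]].

Lemma vanishing_at_fun_ideal : is_ideal vanishing_at_fun.
Proof.
split.
- by move=> x _; rewrite rmorph0 horner0.
- by move=> p q hp hq x sx; rewrite rmorphD hornerD hp // hq // addr0.
- by move=> r p hp x sx; rewrite rmorphM hornerM hp // mulr0.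
Qed.

Lemma leading_coefs_ideal : is_ideal leading_coefs.
Proof.
have [z0 zD zM] := vanishing_at_fun_ideal.
split.
- by exists 0%N, 0; rewrite size_poly0 coef0.
- move=> l l' [N [p [vp sp <-]]] [M [q [vq sq <-]]].
  (* Each polynomial is shifted by the degree bound of the other, which aligns the two
     coefficients. *)
  exists (N + M)%N, ('X^M * p + 'X^N * q); split.
  + by apply: zD; apply: zM.
  + rewrite (leq_trans (size_polyD _ _)) // geq_max.
    have sX k m (r : {poly P}) : (size r <= m.+1)%N -> (size ('X^k * r)%R <= (k + m).+1)%N.
      move=> sr; apply: leq_trans (size_polyMleq _ _) _.
      by rewrite size_polyXn addSn /= -addnS leq_add2l.
    by rewrite [X in (_ <= X.+1)%N && _]addnC !sX.
  + rewrite coefD !coefXnM [X in if X then _ else _]ltnNge leq_addl /=.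
    by rewrite ltnNge leq_addr /= addnK addKn.
- move=> r l [N [p [vp sp <-]]]; exists N, (r%:P * p); split.
  + exact: zM.
  + by rewrite mul_polyC (leq_trans (size_scale_leq _ _)).
  + by rewrite coefCM.
Qed.

Lemma leading_coefs1_integral : reduced_ring A ->
  nonzerodivisor (phi s) -> leading_coefs 1 -> exists N (c : nat -> P),
    phi (a ^+ N + \sum_(i < N) c i * (a ^+ i * s ^+ (N - i))) = 0.
Proof.
move=> A_red /nonzerodivisorP s_nzd [N [p [vp sp pN]]].
(* The equation of [a / s] is known only where [s] does not vanish. A factor [s] makes it hold
   everywhere on [X], and is then cancelled as a nonzerodivisor. *)
exists N, (fun i => p`_i); apply: s_nzd; rewrite -rmorphM.
apply: peval_eq0 => // x; rewrite /peval mevalM.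
have [->|sx] := eqVneq (meval (set_val x ord0) s) 0; first by rewrite mul0r.
have := vp x sx; rewrite (horner_coef_wide _ (leq_trans (size_poly _ _) sp)).
rewrite big_ord_recr /= coef_map pN /= meval1 mul1r => e.
apply/eqP; rewrite mulf_eq0; apply/orP; right; apply/eqP.
have ax : meval (set_val x ord0) a = meval (set_val x ord0) s * f x by rewrite -[LHS]sf.
transitivity (meval (set_val x ord0) s ^+ N * 0); last by rewrite mulr0.
rewrite -[X in _ * X]e mevalD rmorphXn /= ax exprMn raddf_sum mulrDr addrC /=.
congr (_ + _); rewrite mulr_sumr; apply: eq_bigr => i _.
rewrite !mevalM !rmorphXn /= ax coef_map /=.
have -> : meval (set_val x ord0) s ^+ N =
    meval (set_val x ord0) s ^+ i * meval (set_val x ord0) s ^+ (N - i).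
  by rewrite -exprD subnKC // ltnW.
by rewrite exprMn mulrCA -!mulrA; congr (_ * _); rewrite mulrCA mulrA mulrC.
Qed.

(* A zero [p0] of the leading coefficients makes [(p0, 0)] a specialization of a
   generic point [(x, 1 / f(x))]: points of [X] near [p0] then have [1 / f] small
   but nonzero, so that [f] is unbounded at [p0]. *)
Lemma leading_coefs_no_zero (p0 : X) : continuous f ->
  nonzerodivisor (phi s) ->
  ~ (forall l, leading_coefs l -> peval l p0 = 0).
Proof.
move=> /continuous_setP fc /nonzerodivisorP s_nzd lead0.
pose y0 := set_val p0 ord0.
(* The class of ['X] plays [f]. Avoiding [M] keeps [s], ['X] and every polynomial whose leading
   coefficient is nonzero at [p0] from being killed. *)
pose M : set {poly P} := [set q | exists k p,
  meval y0 (lead_coef p) != 0 /\ q = (s ^+ k)%:P * p].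
have [||K [psi [psiJ psiM]]] :=
    @exists_residue_field _ vanishing_at_fun M vanishing_at_fun_ideal.
- split.
    by exists 0%N, 1; rewrite lead_coef1 meval1 oner_eq0 expr0 mulr1.
  move=> _ _ [k [p [p0' ->]]] [l [q [q0 ->]]]; exists (k + l)%N, (p * q).
  by rewrite lead_coefM mevalM mulf_neq0 // exprD polyCM mulrACA.
- rewrite -subset0 => q [Jq [k [p [lp qE]]]].
  suff pl : peval (lead_coef p) p0 = 0 by move/eqP: lp; apply; exact: pl.
  apply: lead0; exists (size p).-1, p; split=> //; last exact: leqSpred.
  move=> x sx; have := Jq x sx; rewrite qE rmorphM /= map_polyC hornerM hornerC /=.
  move/eqP; rewrite mulf_eq0 rmorphXn => /orP[|/eqP//].
  by rewrite expf_eq0 => /andP[_ h]; rewrite /peval h in sx.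
pose iota : {rmorphism Cx R -> K} := psi \o polyC \o @mpolyC n (Cx R).
pose x i := psi (mpolyX (Cx R) (mnm1 i))%:P.
have psiC p : mmap iota x p = psi p%:P.
  pose h : {rmorphism P -> K} := psi \o polyC.
  exact: (esym (mmapE_rmorph h p)).
have Mx p : meval y0 (lead_coef p) != 0 -> psi p != 0.
  by move=> lp; apply: psiM; exists 0%N, p; rewrite expr0 mul1r.
pose w := psi 'X.
have w0 : w != 0 by apply: Mx; rewrite lead_coefX meval1 oner_eq0.
have psi_s : psi s%:P != 0.
  apply: psiM; exists 1%N, 1; rewrite lead_coef1 meval1 oner_eq0 mulr1.
  by rewrite expr1.
pose xz := ord_rcons x w^-1; pose yz := ord_rcons y0 0.
have xzE p : mmap iota xz (mwiden p) = psi p%:P.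
  rewrite mmap_muni muni_mwiden map_polyC hornerC -psiC.
  by rewrite /xz ord_rcons_widen.
have spec : specialization iota xz yz.
  move=> G; rewrite /meval !mmap_muni /xz /yz !ord_rcons_max !ord_rcons_widen.
  set g := muni G => g0; rewrite horner_coef0 coef_map /=.
  apply: contrapT => /eqP g0y.
  have sg : (0 < size g)%N.
    by rewrite size_poly_gt0; apply: contraNneq g0y => ->; rewrite coef0 mmap0.
  (* The reversal of [g]: its leading coefficient is the constant coefficient of [g], and its value
     at [w] is that of [g] at [w^-1] times a power of [w]. *)
  pose p := \poly_(i < size g) g`_((size g).-1 - i).
  have g00 : g`_0 != 0 by apply: contraNneq g0y => ->; rewrite mmap0.
  have sp : size p = size g by rewrite /p size_poly_eq // subnn.
  have lp : lead_coef p = g`_0.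
    by rewrite lead_coefE sp coef_poly ltn_predL sg subnn.
  have : psi p != 0 by apply: Mx; rewrite lp.
  have -> : psi p = w ^+ (size g).-1 * (map_poly (mmap iota x) g).[w^-1].
    rewrite (horner_coef_wide _ (size_poly _ _)) mulr_sumr.
    rewrite /p poly_def rmorph_sum (reindex_inj rev_ord_inj); apply: eq_bigr => i _ /=.
    rewrite -mul_polyC rmorphM rmorphXn -psiC coef_map /= mulrCA.
    have il : (i <= (size g).-1)%N by rewrite -ltnS prednK.
    have -> : ((size g).-1 - (size g - i.+1))%N = i by rewrite -subn1; move: (ltn_ord i); lia.
    congr (_ * _); have -> : (size g - i.+1 = (size g).-1 - i)%N by rewrite -subn1; lia.
    by rewrite -/w exprVn expfB_cond ?(negbTE w0) //.
  by rewrite g0 mulr0 eqxx.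

pose H : mpoly n.+1 (Cx R) := mwiden s * mpolyX _ (mnm1 ord_max).
have Hxz : mmap iota xz H != 0.
  by rewrite /H rmorphM /= xzE mmapX mmap1U /xz ord_rcons_max mulf_neq0 ?invr_eq0.
have [d d0 hd] := fc p0 1 ltr01.
(* [B] bounds [|f|] within distance [d] of [p0]. As the last coordinate [z] is smaller than [B^-1]
   in norm, [|z f| < 1], against [z f = 1]. *)
pose B := `|f p0| + 1.
have B0 : 0 < B by rewrite ltr_wpDl ?ltr01.
have [e [e0 ed eB]] : exists e : Cx R, [/\ 0 < e, e <= d & e <= B^-1].
  by apply: pos_min2 => //; rewrite invr_gt0.
have [y [ys yy yH]] := specialization_dense spec Hxz e0.
pose z := y ord_max; pose v := y \o widen_ord (leqnSn n).
have vK p : phi p = 0 -> meval v p = 0.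
  move=> p0'; rewrite -meval_mwiden; apply: ys; rewrite xzE; apply: psiJ => x' _.
  by rewrite map_polyC hornerC; apply: peval_kernel.
have [q qv] := closed_pointE vK.
(* The last coordinate specializes [1 / f], so the relation [s f = a] becomes [s = z a]. *)
have sazE : meval v s = z * meval v a.
  have sWa : psi s%:P * w = psi a%:P.
    apply/eqP; rewrite -subr_eq0 -rmorphM -rmorphB; apply/eqP/psiJ => x' _.
    rewrite rmorphB rmorphM /= !map_polyC map_polyX hornerD hornerN hornerMX !hornerC.
    by apply/eqP; rewrite subr_eq0; apply/eqP; exact: sf.
  have saz0 : mmap iota xz (mwiden s - mwiden a * mpolyX _ (mnm1 ord_max)) = 0.
    have Xa : mmap iota xz (mwiden a * mpolyX _ (mnm1 ord_max)) = psi a%:P * w^-1.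
      by rewrite rmorphM /= xzE mmapX mmap1U /xz ord_rcons_max.
    by rewrite mmapB Xa xzE -sWa mulfK // subrr.
  have := ys _ saz0; rewrite meval_mwidenBMX => /eqP.
  by rewrite subr_eq0 mulrC => /eqP.
move: yH; rewrite /H meval_mwidenMX mulf_eq0 negb_or => /andP[sv z0].
have zf : z * f q = 1.
  apply: (mulfI sv); rewrite mulr1 {2}sazE mulrCA; congr (_ * _).
  by have := sf q; rewrite /peval qv.
have fq : `|f q| < B.
  have /hd h : forall i, `|set_val q ord0 i - set_val p0 ord0 i| < d.
    move=> i; rewrite qv; apply: lt_le_trans ed.
    have := yy (widen_ord (leqnSn n) i).
    by rewrite /yz -[ord_rcons _ _ _]/((ord_rcons y0 0 \o widen_ord _) i) ord_rcons_widen.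
  rewrite -(subrK (f p0) (f q)) (le_lt_trans (ler_normD _ _)) // /B addrC.
  by rewrite ltrD2l.
have zB : `|z| < B^-1.
  apply: lt_le_trans eB; have := yy ord_max.
  by rewrite /yz ord_rcons_max subr0.
have : `|z * f q| < 1.
  rewrite normrM -(mulVf (lt0r_neq0 B0)).
  by apply: ltr_pM.
by rewrite zf normr1 ltxx.
Qed.

End Integrality.

Lemma dehomogenize (Q : comPzRingType) (al si v : Q) N (c : nat -> Q) :
  si * v = 1 -> al ^+ N + \sum_(i < N) c i * (al ^+ i * si ^+ (N - i)) = 0 ->
  (al * v) ^+ N + \sum_(i < N) c i * (al * v) ^+ i = 0.
Proof.
move=> siv /(congr1 ( *%R (v ^+ N))); rewrite mulr0; apply: etrans.
rewrite mulrDr exprMn mulrC mulr_sumr; congr (_ + _); apply: eq_bigr => i _.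
have -> : v ^+ N = v ^+ i * v ^+ (N - i) by rewrite -exprD subnKC // ltnW.
have vsi : v ^+ (N - i) * si ^+ (N - i) = 1 by rewrite -exprMn mulrC siv expr1n.
transitivity (c i * (al ^+ i * v ^+ i) * (v ^+ (N - i) * si ^+ (N - i))).
  by rewrite vsi mulr1 exprMn.
by move: (v ^+ i) (v ^+ (N - i)) (al ^+ i) (si ^+ (N - i)) => v1 v2 a1 s1; ring.
Qed.

Section Normal.
Context (R : realType) (n : nat) (A : comPzRingType).
Context (phi : {rmorphism mpoly n (Cx R) -> A}).
Hypotheses (phi_surj : forall a : A, exists P, phi P = a).
Hypotheses (A_reduced : reduced_ring A) (A_normal : normal_ring A).
Local Notation X := (closed_points phi).

Lemma normal_division (s a : mpoly n (Cx R)) N (c : nat -> mpoly n (Cx R)) :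
  nonzerodivisor (phi s) ->
  phi (a ^+ N + \sum_(i < N) c i * (a ^+ i * s ^+ (N - i))) = 0 ->
  exists b, phi a = phi b * phi s.
Proof.
move=> s_nzd /(congr1 (to_total_fraction A)); set tf := to_total_fraction A.
have [v sv] : exists v : total_fraction A, tf (phi s) * v = 1.
  exact: TotalFrac.tofrac_unit.
pose u := tf (phi a) * v.
rewrite !rmorphD rmorph_sum !rmorph_sum !rmorphXn rmorph0 => e.
have [|b ub] := A_normal (u := u).
  exists N, (fun i => phi (c i)).
  apply: (dehomogenize (c := fun i => tf (phi (c i))) sv).
  apply: etrans e; congr (_ + _); apply: eq_bigr => i _.
  by rewrite !rmorphM !rmorphXn.
have [B Bb] := phi_surj b; exists B; rewrite Bb.
apply: (@TotalFrac.tofrac_inj A); rewrite -/tf.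
rewrite -[RHS]/(tf (b * phi s)) rmorphM -[tf b]ub /u -mulrA [v * _]mulrC sv.
by rewrite mulr1.
Qed.

Lemma continuous_rational_polynomial (f : X -> Cx R) :
  rational_fun f -> continuous f -> exists B, f = peval B.
Proof.
move=> frat fcont; have [s [a sf] s_nzd] := rational_denominator phi_surj A_reduced frat.
have [lead1|lead1] := pselect (leading_coefs f s 1).
  have [N [c ic]] := leading_coefs1_integral sf A_reduced s_nzd lead1.
  have [B aB] := normal_division s_nzd ic.
  exists B; apply: (continuous_eq_dense s_nzd fcont) => p sp.
  apply: (mulfI sp); rewrite sf.
  have : phi (a - B * s) = 0 by rewrite rmorphB rmorphM aB subrr.
  move=> /(peval_kernel p); rewrite /peval mevalB mevalM => /eqP.
  by rewrite subr_eq0 mulrC => /eqP.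
have [v vlead] := weak_nullstellensatz (leading_coefs_ideal f s) lead1.
have [|p pv] := closed_pointE (phi := phi) (v := v).
  (* As a constant polynomial, an element of the kernel vanishes at [f] and is its own leading
     coefficient; hence [v] is a closed point. *)
  move=> P P0; apply: vlead; exists 0%N, P%:P; split.
  - by move=> x _; rewrite map_polyC hornerC; apply: peval_kernel.
  - exact: size_polyC_leq1.
  - by rewrite coefC.
case: (leading_coefs_no_zero sf (p0 := p) fcont s_nzd) => l /vlead.
by rewrite /peval pv.
Qed.

End Normal.

Theorem proposition4p6 (R : realType) (n : nat) (A : comPzRingType)
    (phi : {rmorphism mpoly n (Cx R) -> A})
    (phi_surj : forall a : A, exists P, phi P = a)
    (A_reduced : reduced_ring A)
    (A_normal : normal_ring A) :
  [/\ continuous_rational_functions (closed_points phi)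
        = regular_functions (closed_points phi),
      regular_functions (closed_points phi) = range (coord_fun phi) &
      injective (coord_fun phi)].
Proof.
have regE := regular_functionsE phi_surj.
split; [apply/seteqP; split=> f | exact: regE | exact: coord_fun_inj].
  move=> [frat fcont]; rewrite regE; apply/(coord_fun_range phi_surj).
  exact: continuous_rational_polynomial.
move=> freg; split.
  exists setT; split=> //; first exact: zariski_open_setT.
  by move=> Z _ ZT; apply/seteqP; split=> // x _; apply: ZT.
move: freg; rewrite regE => /(coord_fun_range phi_surj)[P ->].
exact: continuous_peval.
Qed.
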